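(* Let $k\ge 2$, $3\le r\le 2k$ and $n\ge 712k$ be integers. Suppose that $G$ is an $n$-vertex graph containing no cycle $C_{2k+1}$ with $\lambda(G)\ge \lambda(T_{n-r+1,2}\circ K_r)$. Then $G\in\mathcal{G}_{n,r}$, unless $G= T_{n-r+1,2}\circ K_r$ (up to isomorphism).
   Context: $\lambda(G)$ denotes the spectral radius (largest eigenvalue) of the adjacency matrix of $G$. $T_{m,2}$ denotes the complete bipartite graph on $m$ vertices with parts of sizes $\lfloor m/2\rfloor$ and $\lceil m/2\rceil$. $T_{n-r+1,2}\circ K_r$ is the $n$-vertex graph obtained by identifying a vertex of the complete graph $K_r$ with a vertex of the smaller part (of size $\lfloor (n-r+1)/2\rfloor$) of $T_{n-r+1,2}$. A graph $H$ is said to be suspended on a graph $B$ if $H$ intersects $B$ in exactly one vertex. $\mathcal{G}_{n,r}$ is the family of $n$-vertex graphs obtained from a bipartite graph $B$ by suspending graphs $G_1,\dots,G_s$ on $B$ (for some $s\in\mathbb{N}$), i.e. the graph is $B\cup G_1\cup\dots\cup G_s$ with each $G_i$ meeting $B$ in exactly one vertex, where $\sum_{i=1}^s|V(G_i)\setminus V(B)|\le r-2$. *)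

(* Defs.v *)
From HB Require Import structures.
From mathcomp Require Import all_boot all_order all_algebra.
From mathcomp Require Import boolp classical_sets reals.
Set Implicit Arguments. Unset Strict Implicit. Unset Printing Implicit Defensive.
Import Order.TTheory GRing.Theory Num.Theory.

Definition simple_graph (n : nat) (G : rel 'I_n) : Prop :=
  symmetric G /\ irreflexive G.

Definition adjmx (R : realType) (n : nat) (G : rel 'I_n) : 'M[R]_n :=
  \matrix_(i, j) ((G i j)%:R)%R.

(* spectral radius = largest eigenvalue of the (real symmetric) adjacency
   matrix, i.e. the supremum (= maximum, the set being finite) of the set
   of its eigenvalues. *)
Definition spec_radius (R : realType) (n : nat) (G : rel 'I_n) : R :=
  sup [set a : R | eigenvalue (adjmx R G) a].

Definition has_cycle (n m : nat) (G : rel 'I_n) : Prop :=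
  exists f : 'I_m -> 'I_n, injective f /\ forall i : 'I_m, G (f i) (f (ordS i)).

Definition graph_iso (n : nat) (G H : rel 'I_n) : Prop :=
  exists f : 'I_n -> 'I_n, bijective f /\ forall u v, G u v = H (f u) (f v).

(* T_{n-r+1,2} o K_r on vertex set 'I_n.
   K_r occupies the vertices 0..r-1; vertex 0 is the identified vertex.
   T_{m,2} (m = n-r+1) occupies vertex 0 and the vertices r..n-1.
   Its smaller part (size a = floor(m/2)) is vertex 0 together with the
   vertices r .. r+a-2; the larger part is r+a-1 .. n-1. *)
Definition in_T (n r : nat) (v : 'I_n) : bool := (v == 0 :> nat) || (r <= v).
Definition in_small (n r : nat) (v : 'I_n) : bool :=
  let a := (n - r + 1)./2 in (v == 0 :> nat) || ((r <= v) && (v < r + a - 1)).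
Definition TK (n r : nat) : rel 'I_n := fun u v =>
  [&& in_T r u, in_T r v & in_small r u != in_small r v]
  || [&& u < r, v < r & u != v].

Definition bipartite_on (n : nat) (VB : {set 'I_n}) (EB : rel 'I_n) : Prop :=
  exists c : 'I_n -> bool, forall u v, EB u v -> c u != c v.

Definition in_family (n r : nat) (G : rel 'I_n) : Prop :=
  exists (VB : {set 'I_n}) (EB : rel 'I_n) (s : nat)
         (VG : 'I_s -> {set 'I_n}) (EG : 'I_s -> rel 'I_n),
    [/\ (forall u v, EB u v -> (u \in VB) && (v \in VB)),
        symmetric EB, irreflexive EB & bipartite_on VB EB]
    /\ [/\ (forall i u v, EG i u v -> (u \in VG i) && (v \in VG i)),
        (forall i, symmetric (EG i) /\ irreflexive (EG i)) &
        (forall i, #|VG i :&: VB| = 1%N)]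
    /\ (VB :|: \bigcup_(i < s) VG i = [set: 'I_n])
    /\ (forall u v, G u v = EB u v || [exists i : 'I_s, EG i u v])
    /\ (\sum_(i < s) #|VG i :\: VB| <= r - 2)%N.
Arguments TK : clear implicits.
Arguments in_family {n} r G.
Arguments spec_radius R {n} G.

(* Main.v *)
Require Import Defs.
From HB Require Import structures.
From mathcomp Require Import all_boot all_order all_algebra.
From mathcomp Require Import boolp classical_sets reals.
From mathcomp Require Import zify ring lra.
From mathcomp Require Import fintype finset perm.
Import Order.TTheory GRing.Theory Num.Theory.

Set Implicit Arguments. Unset Strict Implicit. Unset Printing Implicit Defensive.

(* Write m = n - r + 1, a = floor (m / 2) and b = m - a.  The target graph has an
   eigenvalue lam0 with lam0^2 = a b + b (r - 1) / ((lam0 + 1) (lam0 - r + 1)), so G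
   has an eigenvalue lam >= lam0, and the absolute values x of an eigenvector satisfy
   lam x <= A x.  By duality, a positive vector y with A y <= lam y is tight on the
   support of x, so it suffices to exhibit suitable vectors y.

   Counting 2-walks from a maximum of x yields an almost complete bipartite core,
   inside which paths of prescribed length and ends exist.  As G has no C_{2k+1}, the
   core is bipartite and every ear of the core with the wrong parity has at least
   2k - 1 >= r - 1 inner vertices.  If a wrong ear exists, the inner vertices of a
   shortest one have negligible weight, and a vector y with A y <= lam y, somewhere
   strictly, gives a contradiction.  Otherwise, adding ears of the right parity as long
   as possible produces a bipartite set B such that each component of G - B is attached
   to at most one vertex of B.  If |G - B| <= r - 2 then G is in the family; otherwise
   the vector y of the graph obtained by completing B and the suspended parts forces
   |G - B| = r - 1 and then all the equalities that characterise the target graph. *)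

(** The lower bound for lam^2 exceeds a b only by about 2 (r - 1) / n, so estimates correct to
    leading order decide nothing: vertices have to be counted exactly. A wrong ear takes 2k - 1 >= r
    - 1 vertices away from the bipartite part, which leaves at most m; for r = 2k this is m itself,
    and the small but positive weight of the inner vertices must be paid for by slack at the two
    ends of the ear. In the same way, if |G - B| = r - 1, integrality first forces balanced classes,
    and only then do the terms of order 1/n decide where the suspended vertices sit; there [gain] is
    strictly superadditive. G need not be connected, so x may vanish at some vertices. The completed
    graph is connected, and tightness lets the support of x spread along its edges to all vertices.
    The ratio 712 enters through 12/712 + 12/712^2 < (13/100)^2, which bounds the imbalance and the
    number of missing edges of the core. *)

Ltac nlia :=
  rewrite /=;
  repeat match goal with
  | [ H : is_true (leq _ _) |- _ ] => revert H
  | [ H : is_true (leq _ _ && leq _ _) |- _ ] => revert H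
  | [ H : @eq nat _ _ |- _ ] => revert H
  end; clear; rewrite /=; lia.

(** * Paths between rich vertices *)

Lemma has_cycle_seq (n m : nat) (G : rel 'I_n) (c : seq 'I_n) :
  cycle G c -> uniq c -> size c = m -> has_cycle m G.
Proof.
case: c => [|x0 c] cyc un szm.
  rewrite -szm; have no0 (i : 'I_0) : False by case: i.
  by exists (fun i => False_rect _ (no0 i)); split=> [i|i]; case: (no0 i).
rewrite -szm; exists (fun i => nth x0 (x0 :: c) i); split.
  move=> i j eqij; apply/val_inj/eqP.
  by rewrite -(nth_uniq x0 _ _ un) ?eqij ?ltn_ord.
move=> i; have mi : nth x0 (x0 :: c) i \in x0 :: c by rewrite mem_nth.
have := next_cycle cyc mi; rewrite next_nth mi index_uniq //.
congr (G _ _); rewrite /=; have := ltn_ord i; rewrite /= ltnS leq_eqVlt.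
(* At the last index [ordS] wraps round to 0, and the default value of [nth] is the head of the
   cycle as well. *)
case/orP=> [/eqP->|lti]; first by rewrite modnn /= nth_default.
by rewrite modn_small // ltnS.
Qed.

Section Closing.
Variables (T : finType) (G : rel T).
Hypothesis symG : symmetric G.

Definition nbr (A : {set T}) (v : T) : {set T} := [set u in A | G v u].

(* The threshold ensures that two vertices rich in A have more than K common
   neighbours in A. *)
Definition rich (K : nat) (A : {set T}) (v : T) : bool :=
  #|A| + K < 2 * #|nbr A v|.

Lemma pick_nbr (K : nat) (A : {set T}) (v : T) (F : seq T) :
  rich K A v -> size F < K -> exists u, [/\ u \in A, G v u & u \notin F].
Proof.
rewrite /rich => rv szF.
have leA : #|nbr A v| <= #|A| by apply/subset_leq_card/subsetP => x; rewrite inE => /andP[].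
have : 0 < #|nbr A v :\: [set x in F]|.
  have := cardsID [set x in F] (nbr A v).
  have : #|nbr A v :&: [set x in F]| <= size F.
    apply: leq_trans (card_size F); rewrite -[#|mem F|]cardsE.
    by apply/subset_leq_card/subsetIr.
  nlia.
by case/card_gt0P=> u; rewrite !inE => /and3P[uF uA vu]; exists u.
Qed.

Lemma pick_common (K : nat) (A : {set T}) (v w : T) (F : seq T) :
  rich K A v -> rich K A w -> size F < K ->
  exists u, [/\ u \in A, G v u, G w u & u \notin F].
Proof.
rewrite /rich => rv rw szF.
have := cardsUI (nbr A v) (nbr A w).
have leA : #|nbr A v :|: nbr A w| <= #|A|.
  by apply/subset_leq_card/subsetP => x; rewrite !inE => /orP[]/andP[].
move=> cUI.
have : 0 < #|(nbr A v :&: nbr A w) :\: [set x in F]|.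
  have := cardsID [set x in F] (nbr A v :&: nbr A w).
  have : #|nbr A v :&: nbr A w :&: [set x in F]| <= size F.
    apply: leq_trans (card_size F); rewrite -[#|mem F|]cardsE.
    by apply/subset_leq_card/subsetIr.
  nlia.
by case/card_gt0P=> u; rewrite !inE => /and3P[uF /andP[uA vu] /andP[_ wu]]; exists u.
Qed.

(** The path advances by two vertices at a time, one in [B] and one in [A], and finally closes with
    a common neighbour of its ends. Visited vertices join [F], so [size F + 2 * j] is constant along
    the induction. Initially [F] is the ear that the path completes to a cycle. *)
Lemma even_path (K : nat) (A B : {set T}) :
  {in A, forall v, rich K B v} -> {in B, forall v, rich K A v} ->
  forall (j : nat) (F : seq T) (s t : T), s != t -> rich K B s -> rich K B t ->
  size F + 2 * j + 3 < K ->
  exists p, [/\ size p = (2 * j).+1, path G s (rcons p t), uniq (s :: rcons p t),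
    {subset p <= A :|: B} & {in p, forall x, x \notin F}].
Proof.
move=> rA rB; elim=> [|j IH] F s t st rs rt szF.
  have [|u] := @pick_common K B s t [:: s, t & F] rs rt; first by nlia.
  rewrite !inE !negb_or => -[uB su tu /and3P[us ut uF]].
  exists [:: u]; rewrite /= su symG tu !inE !negb_or eq_sym us st ut /=.
  by split=> // x; rewrite !inE => /eqP->; rewrite ?uB ?orbT.
have [|u] := @pick_nbr K B s [:: s, t & F] rs; first by nlia.
rewrite !inE !negb_or => -[uB su /and3P[us ut uF]].
have [|w] := @pick_nbr K A u [:: s, t, u & F] (rB _ uB); first by nlia.
rewrite !inE !negb_or => -[wA uw /and4P[ws wt wu wF]].
have [|p [szp pp up sp Fp]] := IH [:: s, u & F] w t wt (rA _ wA) rt; first by nlia.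
have /= np : forall x, x \in p -> [&& x != s, x != u & x \notin F].
  by move=> x /Fp; rewrite !inE !negb_or.
have ns : s \notin p by apply/negP => /np; rewrite eqxx.
have nu : u \notin p by apply/negP => /np; rewrite eqxx andbF.
exists [:: u, w & p]; split.
- by nlia.
- by rewrite /= su uw.
- move: up; rewrite /= !mem_rcons !inE !negb_or => /andP[-> ->].
  by rewrite !(mem_rcons, inE) !negb_or ns nu st ut !(eq_sym s) us ws (eq_sym u) wu.
- move=> x; rewrite !inE => /or3P[/eqP->|/eqP->|/sp]; rewrite ?uB ?wA ?orbT ?inE //.
- by move=> x; rewrite !inE => /or3P[/eqP->|/eqP->|/np /and3P[]].
Qed.

Lemma odd_path (K : nat) (A B : {set T}) :
  {in A, forall v, rich K B v} -> {in B, forall v, rich K A v} ->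
  forall (j : nat) (F : seq T) (s t : T), s != t -> rich K B s -> rich K A t ->
  size F + 2 * j + 4 < K ->
  exists p, [/\ size p = (2 * j).+2, path G s (rcons p t), uniq (s :: rcons p t),
    {subset p <= A :|: B} & {in p, forall x, x \notin F}].
Proof.
move=> rA rB j F s t st rs rt szF.
have [|u] := @pick_nbr K B s [:: s, t & F] rs; first by nlia.
rewrite !inE !negb_or => -[uB su /and3P[us ut uF]].
have [|p [szp pp up sp Fp]] := even_path rB rA (j := j) (F := s :: F) ut (rB _ uB) rt.
  by nlia.
have /= np : forall x, x \in p -> (x != s) && (x \notin F).
  by move=> x /Fp; rewrite !inE !negb_or.
have ns : s \notin p by apply/negP => /np; rewrite eqxx.
exists (u :: p); split.
- by rewrite /= szp.
- by rewrite /= su.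
- move: up; rewrite /= !mem_rcons !inE !negb_or => ->.
  by rewrite !(mem_rcons, inE) !negb_or ns st (eq_sym s) us.
- by move=> x; rewrite inE => /orP[/eqP->|/sp]; rewrite !inE ?uB ?orbT // orbC.
- by move=> x; rewrite !inE => /orP[/eqP->|/np /andP[]].
Qed.

Lemma cycle_of_paths (s t : T) (q p : seq T) :
  path G s (rcons q t) -> uniq (s :: rcons q t) -> path G t (rcons p s) ->
  uniq (t :: rcons p s) -> {in p, forall x, x \notin q} ->
  cycle G (s :: q ++ t :: p) /\ uniq (s :: q ++ t :: p).
Proof.
move=> pq uq pp up dis; split.
  rewrite /= -cats1 -catA cat_path; move: pq pp.
  by rewrite !rcons_path /= cats1 rcons_path => /andP[-> ->] /andP[-> ->].
move: uq up; rewrite /= !mem_rcons !rcons_uniq !inE !mem_cat !inE !negb_or cat_uniq /=.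
move=> /and3P[/andP[st sq] tq uq] /and3P[/andP[_ tp] sp up].
rewrite sq st sp uq tp up negb_or tq /= ?andbT.
by apply/hasPn => x /dis.
Qed.

End Closing.

(** * Ears *)

Section Ears.
Variables (T : finType) (G : rel T).
Hypothesis symG : symmetric G.

Definition ear (S : {set T}) (s : T) (q : seq T) (t : T) : bool :=
  [&& s \in S, t \in S, path G s (rcons q t), uniq (s :: rcons q t)
    & all (fun x => x \notin S) q].

(* The path s, q, t has length size q + 1, so it agrees with a 2-colouring c iff
   c s (+) c t = odd (size q).+1.  For q = [::] this is a monochromatic edge of S. *)
Definition wrong_ear (S : {set T}) (c : T -> bool) (s : T) (q : seq T) (t : T) :=
  ear S s q t && (c s (+) c t == odd (size q)).

Lemma ear_rev (S : {set T}) s q t : ear S s q t -> ear S t (rev q) s.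
Proof.
case/and5P=> sS tS pq uq aq; rewrite /ear sS tS all_rev aq andbT /=.
have -> : path G t (rcons (rev q) s) = path G s (rcons q t).
  have := rev_path G s (rcons q t).
  rewrite last_rcons belast_rcons rev_cons => ->.
  by apply: eq_path => x y; rewrite symG.
rewrite pq; move: uq; rewrite -rev_uniq rev_cons rev_rcons.
by move=> uq; apply/andP; split.
Qed.

Lemma wrong_ear_rev (S : {set T}) c s q t :
  wrong_ear S c s q t -> wrong_ear S c t (rev q) s.
Proof. by case/andP=> /ear_rev eq cq; rewrite /wrong_ear eq size_rev addbC. Qed.

(** Prolongs both ends of a wrong ear of [B'] inside [B'] until they reach [B]. The prolongations
    respect the colours, so the parity stays wrong. The path [u] ends in [x], and it is empty when
    [x] is already in [B]; similarly for [v] and [y]. *)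
Lemma wrong_ear_join (B B' : {set T}) (c c' : T -> bool) s u x r y v t :
  B \subset B' -> wrong_ear B' c' x r y ->
  path G s u -> last s u = x -> path G y v -> last y v = t ->
  s \in B -> t \in B -> {in u, forall z, z \notin B} ->
  {in belast y v, forall z, z \notin B} -> uniq (s :: u ++ y :: v) ->
  {subset s :: u ++ y :: v <= B'} ->
  c' x = c s (+) odd (size u) -> c' y = c t (+) odd (size v) ->
  wrong_ear B c s (u ++ r ++ belast y v) t.
Proof.
move=> BB' /andP[/and5P[xB' yB' pr ur ar] /eqP cr] pu lu pv lv sB tB uB vB un sub cx cy.
have rnB z : z \in r -> z \notin B' by move/(allP ar).
have eqs : rcons (u ++ r ++ belast y v) t = u ++ r ++ y :: v.
  by rewrite -lv !rcons_cat -lastI.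
rewrite /wrong_ear /ear sB tB eqs !andTb; apply/andP; split; last first.
  rewrite !size_cat size_belast !oddD -cr cx cy.
  by case: (c s) (c t) (odd _) (odd _) => [] [] [] [].
apply/and3P; split.
- move: pr; rewrite /= !cat_path pu lu rcons_path => /andP[-> /= ->].
  by rewrite pv.
- rewrite -[uniq _]/(uniq ((s :: u) ++ r ++ y :: v)) uniq_catCA cat_uniq.
  apply/and3P; split.
  + by move: ur; rewrite /= rcons_uniq => /and3P[].
  + apply/hasPn => z; rewrite [z \in _](_ : _ = (z \in s :: u ++ y :: v)) // => /sub zB.
    by apply/negP => /rnB; rewrite zB.
  + by [].
- rewrite !all_cat; apply/and3P; split; apply/allP => z zz.
  + exact: uB.
  + by apply: contra (rnB _ zz); apply: (fintype.subsetP BB').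
  + exact: vB.
Qed.

(** Alternating colours along [q], the first opposite to [b]. The splittings of [q] match those
    produced when the end of a wrong ear is located in [q]. *)
Definition ear_colour (c c' : T -> bool) (b : T) (q : seq T) : Prop :=
  forall q1 x q2, q = q1 ++ x :: q2 -> c' x = c b (+) odd (size q1).+1.

Lemma ear_colour_rev c c' b q b' :
  c b (+) c b' != odd (size q) -> ear_colour c c' b q -> ear_colour c c' b' (rev q).
Proof.
move=> pq cq q1 x q2 eqq.
have eq : q = rev q2 ++ x :: rev q1.
  by rewrite -[q]revK eqq rev_cat rev_cons cat_rcons.
rewrite (cq _ _ _ eq); move: pq; rewrite eq size_cat /= !size_rev oddD /=.
by case: (c b) (c b') (odd _) (odd _) => [] [] [] [].
Qed.

Lemma wrong_ear_ext_in (B : {set T}) (c c' : T -> bool) b q b' x r y :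
  ear B b q b' -> {in B, c' =1 c} -> ear_colour c c' b q ->
  x \in q -> y \in B -> y != b ->
  wrong_ear (B :|: [set z in q]) c' x r y -> exists s r' t, wrong_ear B c s r' t.
Proof.
move=> /and5P[bB bB' pq uq aq] cB cq xq yB yb wxy.
case/splitPr eqq : q / xq => [q1 q2].
have qB z : z \in q -> z \notin B by move/(allP aq).
have q1B z : z \in rcons q1 x -> z \notin B.
  by rewrite mem_rcons => zz; apply: qB; rewrite eqq mem_cat; move: zz; rewrite !inE => /orP[]->; rewrite ?orbT.
exists b, (rcons q1 x ++ r ++ [::]), y.
apply: (@wrong_ear_join B _ c c' b (rcons q1 x) x r y [::] y (subsetUl _ _) wxy) => //.
- by move: pq; rewrite eqq -cat_rcons rcons_cat cat_path => /andP[].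
- by rewrite last_rcons.
- have : uniq (b :: rcons q1 x).
    apply: subseq_uniq uq; rewrite eqq -cat_rcons rcons_cat.
    by rewrite -cat_cons; apply: prefix_subseq.
  rewrite -[b :: _ ++ _]/((b :: rcons q1 x) ++ [:: y]) cat_uniq => -> /=.
  rewrite !andbT !orbF inE negb_or yb; apply/negP => /q1B.
  by rewrite yB.
- move=> z; rewrite !inE mem_cat !inE => /or3P[/eqP->|zz|/eqP->]; rewrite ?bB ?yB //.
  by move: zz; rewrite eqq mem_rcons mem_cat !inE => /orP[]->; rewrite ?orbT.
- by rewrite (cq _ _ _ eqq) size_rcons.
- by rewrite addbF cB.
Qed.

(* An end of a wrong ear that lies inside the new right ear q can be prolonged
   along q to B in two directions, one of which avoids the other end. *)
Lemma wrong_ear_ext (B : {set T}) (c c' : T -> bool) b q b' x r y :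
  ear B b q b' -> c b (+) c b' != odd (size q) ->
  {in B, c' =1 c} -> ear_colour c c' b q ->
  wrong_ear (B :|: [set z in q]) c' x r y -> exists s r' t, wrong_ear B c s r' t.
Proof.
move=> eq pq cB cq.
have cq' := ear_colour_rev pq cq.
have eq' := ear_rev eq.
have rB : B :|: [set z in rev q] = B :|: [set z in q].
  by apply/setP => z; rewrite !inE mem_rev.
case/and5P: (eq) => bB bB' paq uq aq.
have inq : forall x r y, x \in q -> y \in B ->
    wrong_ear (B :|: [set z in q]) c' x r y -> exists s r' t, wrong_ear B c s r' t.
  move=> {}x {}r {}y xq yB wxy; have [yb|yb] := eqVneq y b.
    apply: (wrong_ear_ext_in eq' cB cq' (x := x) (y := y) (r := r)); rewrite ?mem_rev ?rB //.
    by move: uq; rewrite yb /= mem_rcons inE negb_or => /andP[/andP[]].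
  exact: (wrong_ear_ext_in eq cB cq xq yB yb wxy).
(* Both ends lie in [q]: the one nearer to [b] is continued back to [b] and the other one forward to
   [b'], so the prolongations are disjoint. *)
have inqq : forall q1 q2 q3 x r y, q = q1 ++ x :: q2 ++ y :: q3 ->
    wrong_ear (B :|: [set z in q]) c' x r y -> exists s r' t, wrong_ear B c s r' t.
  move=> q1 q2 q3 {}x {}r {}y eqq wxy.
  have qB z : z \in q -> z \notin B by move/(allP aq).
  exists b, (rcons q1 x ++ r ++ belast y (rcons q3 b')), b'.
  have eqq' : q = (q1 ++ x :: q2) ++ y :: q3 by rewrite eqq -catA.
  apply: (@wrong_ear_join B _ c c' b (rcons q1 x) x r y (rcons q3 b') b' (subsetUl _ _) wxy) => //.
  - by move: paq; rewrite eqq -cat_rcons rcons_cat cat_path => /andP[].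
  - by rewrite last_rcons.
  - by move: paq; rewrite eqq' rcons_cat cat_path => /andP[_] /= /andP[].
  - by rewrite last_rcons.
  - move=> z; rewrite mem_rcons => zz; apply: qB; rewrite eqq !(mem_cat, inE).
    by move: zz; rewrite inE => /orP[]->; rewrite ?orbT.
  - move=> z; rewrite belast_rcons => zz; apply: qB; rewrite eqq !(mem_cat, inE).
    by move: zz; rewrite inE => /orP[]->; rewrite ?orbT.
  - apply: subseq_uniq uq; rewrite eqq /= eqxx.
    rewrite -(cat_rcons x) rcons_cat; apply: cat_subseq => //.
    by rewrite rcons_cat /=; apply: (suffix_subseq q2 (y :: rcons q3 b')).
  - move=> z; rewrite !(mem_cat, inE, mem_rcons) eqq !(mem_cat, inE).
    move=> /or3P[/eqP->|/orP[]->|/or3P[->|/eqP->|->]]; rewrite ?bB ?bB' ?orbT //.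
  - by rewrite (cq _ _ _ eqq) size_rcons.
  - rewrite (cq _ _ _ eqq') size_rcons; move: pq; rewrite eqq' size_cat /= oddD /=.
    by case: (c b) (c b') (odd _) (odd _) => [] [] [] [].
move=> wxy; have [xB yB] : x \in B :|: [set z in q] /\ y \in B :|: [set z in q].
  by case/andP: wxy => /and5P[].
rewrite !inE in xB yB; case/orP: xB => xB; case/orP: yB => yB.
- exists x, ([::] ++ r ++ [::]), y.
  apply: (@wrong_ear_join B _ c c' x [::] x r y [::] y (subsetUl _ _) wxy) => //.
  + rewrite /= inE; case/andP: wxy => /and5P[_ _ _ /=].
    by rewrite mem_rcons inE negb_or => /andP[/andP[->]].
  + by move=> z; rewrite !inE => /orP[]/eqP->; rewrite ?xB ?yB.
  + by rewrite addbF cB.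
  + by rewrite addbF cB.
- exact: inq yB xB (wrong_ear_rev wxy).
- exact: inq xB yB wxy.
have nxy : x != y.
  by case/andP: wxy => /and5P[_ _ _ /=]; rewrite mem_rcons inE negb_or => /andP[/andP[]].
case/splitPr eqq : q / xB => [q1 q2].
move: yB; rewrite eqq mem_cat inE eq_sym (negPf nxy) /= => /orP[] yy.
- case/splitPr eqq1 : q1 / yy => [q3 q4].
  apply: (inqq q3 q4 q2 y (rev r) x); last exact: wrong_ear_rev.
  by rewrite eqq eqq1 -catA.
- case/splitPr eqq2 : q2 / yy => [q3 q4].
  by apply: (inqq q1 q3 q4 x r y) => //; rewrite eqq eqq2.
Qed.

(** The absence of wrong ears is the invariant: it makes alternating colours on a new ear fit at
    both ends, and by [wrong_ear_ext] it survives the absorption of that ear. Each absorbed ear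
    shrinks the complement. *)
Lemma ear_closure (S : {set T}) (c : T -> bool) :
  (forall s q t, ~~ wrong_ear S c s q t) ->
  exists (B : {set T}) (c' : T -> bool),
    [/\ S \subset B, (forall s q t, ~~ wrong_ear B c' s q t)
      & forall s q t, ear B s q t -> q = [::]].
Proof.
move: {2}#|~: S| (leqnn #|~: S|) => m; elim: m S c => [|m IH] S c leS nw.
  exists S, c; split=> // s [//|x q] t /and5P[_ _ _ _ /andP[xS _]].
  have : x \in ~: S by rewrite inE.
  by move: leS; rewrite leqn0 cards_eq0 => /eqP->; rewrite inE.
case: (pselect (exists e, ear S e.1.1 e.1.2 e.2 /\ e.1.2 <> [::])); last first.
  move=> ne; exists S, c; split=> // s q t eq.
  by apply: contra_notP ne => q0; exists (s, q, t).
case=> -[[b q] b'] /= [eq q0].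
have pq : c b (+) c b' != odd (size q) by have := nw b q b'; rewrite /wrong_ear eq.
pose c' x := if x \in q then c b (+) odd (index x q).+1 else c x.
have /and5P[_ _ _ uq aq] := eq.
have cS : {in S, c' =1 c}.
  by move=> x xS; rewrite /c' ifN //; apply: contraL xS => /(allP aq).
have cq : ear_colour c c' b q.
  move=> q1 x q2 eqq; rewrite /c' eqq mem_cat inE eqxx orbT index_cat /= eqxx addn0.
  case: ifP => // xq1; move: uq; rewrite eqq /= => /andP[_].
  by rewrite rcons_uniq cat_uniq /= xq1 /= !andbF.
have [||B [c'' [SB nB eB]]] := IH (S :|: [set z in q]) c'.
- rewrite -ltnS (leq_trans _ leS) //; apply: proper_card; rewrite properC.
  apply/properP; split; first exact: subsetUl.
  case: q {pq uq cS cq c' eq} q0 aq => [//|x q] _ /andP[xS _].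
  by exists x; rewrite // !inE eqxx orbT.
- move=> x r y; apply/negP => wxy.
  have [s [r' [t]]] := wrong_ear_ext eq pq cS cq wxy.
  by apply/negP.
by exists B, c''; split=> //; apply: fintype.subset_trans SB; apply: subsetUl.
Qed.

(** Two different attachments of one component outside [B] would be joined by a path through that
    component, which is a nonempty ear. *)
Lemma attachment (B : {set T}) (b0 : T) :
  b0 \in B -> (forall s q t, ear B s q t -> q = [::]) ->
  exists att : T -> T, [/\ forall w, att w \in B, {in B, att =1 id},
    (forall u w, u \notin B -> w \notin B -> G u w -> att u = att w)
    & forall b w, b \in B -> w \notin B -> G b w -> att w = b].
Proof.
move=> b0B nE.
pose GW := [rel u v | [&& u \notin B, v \notin B & G u v]].
have one b b' w w' : b \in B -> b' \in B -> w \notin B -> G b w -> G b' w' ->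
    connect GW w w' -> b = b'.
  move=> bB bB' wB bw bw' /connectP[p0 pp0 lw']; apply/eqP; apply: contraT => bb'.
  case/shortenP: pp0 lw' => p pp up _ {p0} lw'.
  have pB : all (fun x => x \notin B) (w :: p).
    rewrite /= wB; apply/allP => z; elim: p w {wB bw up lw'} pp => //= x p IH w.
    by rewrite inE => /andP[/and3P[_ xB _] pp] /orP[/eqP->//|]; apply: IH pp.
  have : ear B b (w :: p) b'.
    rewrite /ear bB bB' pB andbT !andTb; apply/andP; split.
      rewrite rcons_path /= bw -lw' symG bw' andbT.
      by apply: sub_path pp => x y /and3P[].
    rewrite -[b :: _]/(b :: rcons (w :: p) b') cons_uniq rcons_uniq mem_rcons.
    rewrite in_cons negb_or bb' up andbT.
    by apply/andP; split; [apply: contraL bB | apply: contraL bB'] => /(allP pB).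
  by move/nE.
have symGW : connect_sym GW.
  by apply: sym_connect_sym => x y /=; rewrite symG andbCA.
(* A component without any neighbour in [B] gets the default [b0]. *)
pose att w := if w \in B then w else
  odflt b0 [pick b in B | [exists w', connect GW w w' && G b w']].
exists att; split.
- move=> w; rewrite /att; case: ifP => // _; case: pickP => //= b.
  by case/andP.
- by move=> w wB; rewrite /att wB.
- move=> u w uB wB uw; rewrite /att (negPf uB) (negPf wB); congr odflt.
  apply: eq_pick => b; congr (_ && _); apply: eq_existsb => w'; congr (_ && _).
  by apply: same_connect symGW _ _ _ _; apply: connect1; rewrite /= uB wB.
- move=> b w bB wB bw; rewrite /att (negPf wB); case: pickP => [b'|] /=.
    case/andP=> bB' /existsP[w' /andP[ww' bw']].
    by rewrite (one b b' w w').
  by move/(_ b); rewrite bB => /existsP[]; exists w; rewrite connect0.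
Qed.
End Ears.

(** * The bipartite core *)

Section Core.
Variables (n k : nat) (G : rel 'I_n) (H : bool -> {set 'I_n}).
Hypotheses (symG : symmetric G) (k2 : 2 <= k).
Hypothesis noC : ~ has_cycle (2 * k + 1) G.
Hypothesis richH : forall b, {in H b, forall v : 'I_n, rich G (4 * k) (H (~~ b)) v}.

Definition core : {set 'I_n} := [set v | rich G (4 * k) (H false) v || rich G (4 * k) (H true) v].
(** A vertex that sees much of [H false] behaves like one of [H true], hence has side [true]. *)
Definition side (v : 'I_n) : bool := rich G (4 * k) (H false) v.

Lemma close_same (b : bool) s q t :
  rich G (4 * k) (H b) s -> rich G (4 * k) (H b) t -> path G s (rcons q t) ->
  uniq (s :: rcons q t) -> ~~ odd (size q) -> 2 * k - 1 <= size q.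
Proof.
move=> rs rt pq uq oq; rewrite leqNgt; apply/negP => szq.
have := odd_double_half (size q); rewrite (negPf oq) add0n => eqsz.
have st : t != s.
  by move: uq; rewrite /= mem_rcons inE negb_or eq_sym => /andP[/andP[]].
have rA := @richH (~~ b); rewrite negbK in rA.
(* The cycle has [size q + 2 + (2 * j).+1] vertices, which is [2 * k + 1] for
   [j = k - 1 - (size q)./2]. *)
have [|p [szp pp up _ dp]] := @even_path _ G symG (4 * k) (H (~~ b)) (H b) rA (@richH b)
   (k - 1 - (size q)./2) q t s st rt rs; first by nlia.
have [cyc un] := cycle_of_paths pq uq pp up dp.
apply: noC; apply: (has_cycle_seq cyc un).
rewrite /= size_cat /= szp; nlia.
Qed.

Lemma close_opp (b : bool) s q t :
  rich G (4 * k) (H b) s -> rich G (4 * k) (H (~~ b)) t -> path G s (rcons q t) ->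
  uniq (s :: rcons q t) -> odd (size q) -> 2 * k - 1 <= size q.
Proof.
move=> rs rt pq uq oq; rewrite leqNgt; apply/negP => szq.
have := odd_double_half (size q); rewrite oq => eqsz.
have st : t != s.
  by move: uq; rewrite /= mem_rcons inE negb_or eq_sym => /andP[/andP[]].
have rA := @richH (~~ b); rewrite negbK in rA.
have [|p [szp pp up _ dp]] := @odd_path _ G symG (4 * k) (H b) (H (~~ b)) (@richH b) rA
   (k - 2 - (size q)./2) q t s st rt rs; first by nlia.
have [cyc un] := cycle_of_paths pq uq pp up dp.
apply: noC; apply: (has_cycle_seq cyc un).
by rewrite /= size_cat /= szp; nlia.
Qed.

(** Otherwise [v] is the only inner vertex of a path between [H false] and [H true], while
    [close_opp] demands at least [2 * k - 1 > 1] inner vertices. *)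
Lemma rich_not_both v : rich G (4 * k) (H false) v -> rich G (4 * k) (H true) v -> False.
Proof.
move=> r0 r1.
have [|x [x0 vx _]] := @pick_nbr _ G (4 * k) (H false) v [::] r0; first by nlia.
have [|y [y1 vy]] := @pick_nbr _ G (4 * k) (H true) v [:: x; v] r1; first by nlia.
rewrite !inE negb_or => /andP[yx yv].
have [|z [z0 vz]] := @pick_nbr _ G (4 * k) (H false) v [:: y; v] r0; first by nlia.
rewrite !inE negb_or => /andP[zy zv].
have := @close_opp true z [:: v] y (richH z0) (richH y1).
rewrite /= symG vz vy !inE !negb_or zv zy (eq_sym v) yv => /(_ isT isT isT).
by nlia.
Qed.

Lemma core_rich v : v \in core -> rich G (4 * k) (H (~~ side v)) v.
Proof. by rewrite inE /side; case: (boolP (rich _ _ (H false) v)). Qed.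

Lemma sideE b v : rich G (4 * k) (H (~~ b)) v -> (v \in core) /\ side v = b.
Proof.
rewrite inE /side; case: b => /= [->//|r1]; rewrite r1 orbT; split=> //.
by apply/negP => r0; apply: (rich_not_both r0).
Qed.

Lemma H_core b v : v \in H b -> (v \in core) /\ side v = b.
Proof. by move/richH/sideE. Qed.

Lemma core_wrong_ear s q t : wrong_ear G core side s q t -> 2 * k - 1 <= size q.
Proof.
case/andP=> /and5P[/core_rich rs /core_rich rt pq uq _] /eqP par.
case: (boolP (odd (size q))) => oq; rewrite ?oq ?(negPf oq) in par.
  have eqs : side t = ~~ side s by move: par; case: (side s) (side t) => [] [].
  by apply: close_opp rs _ pq uq oq; rewrite -eqs.
have eqs : side t = side s by move: par; case: (side s) (side t) => [] [].
by apply: close_same rs _ pq uq oq; rewrite -eqs.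
Qed.

Lemma core_bip u v : u \in core -> v \in core -> G u v -> u != v -> side u != side v.
Proof.
move=> uS vS uv nuv; apply/negP => /eqP euv.
have : 2 * k - 1 <= size (Nil 'I_n).
  apply: (@core_wrong_ear u [::] v); rewrite /wrong_ear /ear uS vS /= uv euv addbb.
  by rewrite inE nuv.
by nlia.
Qed.

Lemma core_one_sided w u v : w \notin core -> u \in core -> v \in core ->
  G w u -> G w v -> side u = side v.
Proof.
move=> wS uS vS wu wv; case: (eqVneq (side u) (side v)) => // suv; exfalso.
have uv : u != v by apply: contra suv => /eqP->.
have : 2 * k - 1 <= size [:: w].
  apply: (@core_wrong_ear u [:: w] v).
  rewrite /wrong_ear /ear uS vS /= symG wu wv wS !inE negb_or uv.
  have -> : u != w by apply: contraNneq wS => <-.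
  have -> : w != v by apply: contraNneq wS => ->.
  by move: suv; case: (side u) (side v) => [] [].
by nlia.
Qed.

Lemma ear_ends_nonadj s q t : ear G core s q t -> size q = 2 * k - 1 -> ~~ G t s.
Proof.
case/and5P=> _ _ pq uq _ szq; apply/negP => ts; apply: noC.
apply: (@has_cycle_seq _ _ G (s :: rcons q t)) => //=.
  by rewrite rcons_path pq last_rcons.
by rewrite size_rcons szq; nlia.
Qed.

Lemma ear_inner_ends s q t x : ear G core s q t -> size q = 2 * k -> x \in core ->
  G x (head x q) -> G (last x q) x -> False.
Proof.
case/and5P=> _ _ pq uq aq szq xS xh lx; apply: noC.
apply: (@has_cycle_seq _ _ G (x :: q)) => //=.
- rewrite rcons_path lx andbT; case: q pq xh {uq aq szq lx} => //= y q.
  by rewrite rcons_path => /and3P[_ -> _] ->.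
- move: uq; rewrite /= rcons_uniq => /and3P[_ _ ->]; rewrite andbT.
  by apply/negP => /(allP aq); rewrite xS.
- by rewrite szq; nlia.
Qed.

End Core.

(** * Shortest wrong ears *)

Section Shortest.
Variables (T : finType) (G : rel T) (S : {set T}) (c : T -> bool).
Hypothesis symG : symmetric G.

Lemma shortest_wrong_ear s q t : wrong_ear G S c s q t ->
  exists s' q' t', wrong_ear G S c s' q' t' /\
    forall s q t, wrong_ear G S c s q t -> size q' <= size q.
Proof.
move=> wq.
have ex : exists m, `[< exists e, wrong_ear G S c e.1.1 e.1.2 e.2 /\ size e.1.2 = m >].
  by exists (size q); apply/asboolP; exists (s, q, t).
case: (ex_minnP ex) => m /asboolP[[[s1 q1] t1] /= [w1 sz1]] minm.
exists s1, q1, t1; split=> // s2 q2 t2 w2; rewrite sz1; apply: minm.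
by apply/asboolP; exists (s2, q2, t2).
Qed.

(** An edge from [v] to another vertex [x] of [S] splits the ear into one from [s] to [x] and one
    from [x] to [t], both shorter. Their inner vertices number [size q + 1] together, as [v] counts
    twice, so by parity exactly one of the two is wrong. *)
Lemma inner_nbrs s q t q1 v q2 x :
  wrong_ear G S c s q t -> (forall s' q' t', wrong_ear G S c s' q' t' -> size q <= size q') ->
  q = q1 ++ v :: q2 -> q1 <> [::] -> q2 <> [::] -> x \in S -> G v x -> (x == s) || (x == t).
Proof.
move=> /andP[/and5P[sS tS pq uq aq] /eqP cq] minq eqq q10 q20 xS vx.
apply: contraT; rewrite negb_or => /andP[xs xt].
have sz1 : 0 < size q1 by case: (q1) q10.
have sz2 : 0 < size q2 by case: (q2) q20.
have xq : x \notin q by apply: contraL xS => /(allP aq).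
have nl : ~~ wrong_ear G S c s (rcons q1 v) x.
  by apply/negP => /minq; rewrite eqq size_cat size_rcons; nlia.
have nr : ~~ wrong_ear G S c x (v :: q2) t.
  by apply/negP => /minq; rewrite eqq size_cat; nlia.
have el : ear G S s (rcons q1 v) x.
  rewrite /ear sS xS !andTb; apply/and3P; split.
  - move: pq; rewrite eqq -cat_rcons rcons_cat cat_path => /andP[p1 _].
    by rewrite rcons_path p1 last_rcons symG -[G x v]symG.
  - rewrite -rcons_cons rcons_uniq; apply/andP; split.
      rewrite inE negb_or xs; apply: contra xq; rewrite eqq mem_rcons mem_cat !inE.
      by move/orP=> []->; rewrite ?orbT.
    apply: subseq_uniq uq; rewrite eqq -cat_rcons rcons_cat -cat_cons.
    exact: prefix_subseq.
  - apply/allP => z; rewrite mem_rcons => zz; apply: (allP aq); rewrite eqq mem_cat inE.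
    by move: zz; rewrite inE => /orP[]->; rewrite ?orbT.
have er : ear G S x (v :: q2) t.
  rewrite /ear xS tS !andTb; apply/and3P; split.
  - move: pq; rewrite eqq rcons_cat cat_path /= => /andP[_ /andP[_ p2]].
    by rewrite p2 symG vx.
  - rewrite cons_uniq; apply/andP; split.
      rewrite mem_rcons inE negb_or xt; apply: contra xq; rewrite eqq mem_cat !inE.
      by move/orP=> []->; rewrite ?orbT.
    apply: subseq_uniq uq; rewrite eqq rcons_cat -cat_cons.
    exact: suffix_subseq.
  - apply/allP => z zz; apply: (allP aq); rewrite eqq mem_cat inE.
    by move: zz; rewrite inE => /orP[]->; rewrite ?orbT.
move: nl nr cq; rewrite /wrong_ear el er !andTb eqq size_rcons size_cat /= oddD /=.
by case: (c s) (c t) (c x) (odd _) (odd _) => [] [] [] [] [].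
Qed.

End Shortest.

(** * Duality and eigenvalues *)

Local Open Scope ring_scope.

(* Collatz-Wielandt duality: by symmetry of the adjacency matrix A, both
   <y, A x - lam x> and <lam y - A y, x> are nonnegative and they sum to 0. *)
Lemma sub_super_tight (R : realFieldType) (T : finType) (G : rel T) (lam : R) (x y : T -> R) :
  symmetric G -> (forall v, 0 <= x v) -> (forall v, 0 < y v) ->
  (forall v, lam * x v <= \sum_(u | G v u) x u) ->
  (forall v, \sum_(u | G v u) y u <= lam * y v) ->
  (forall v, lam * x v = \sum_(u | G v u) x u) /\
  (forall v, x v = 0 \/ \sum_(u | G v u) y u = lam * y v).
Proof.
move=> symG x0 y0 subx supy.
have exch : \sum_v y v * \sum_(u | G v u) x u = \sum_v x v * \sum_(u | G v u) y u.
  under eq_bigr => v _ do rewrite mulr_sumr.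
  under [RHS]eq_bigr => v _ do rewrite mulr_sumr.
  rewrite (exchange_big_dep predT) //=; apply: eq_bigr => u _.
  under eq_bigl => v do rewrite symG.
  by apply: eq_bigr => v _; apply: mulrC.
have p1 v : 0 <= y v * (\sum_(u | G v u) x u - lam * x v).
  by rewrite mulr_ge0 ?subr_ge0 // ltW.
have p2 v : 0 <= x v * (lam * y v - \sum_(u | G v u) y u).
  by rewrite mulr_ge0 ?subr_ge0.
have : \sum_v (y v * (\sum_(u | G v u) x u - lam * x v)
    + x v * (lam * y v - \sum_(u | G v u) y u)) = 0.
  rewrite big_split /=.
  under eq_bigr => v _ do rewrite mulrBr.
  under [X in _ + X]eq_bigr => v _ do rewrite mulrBr.
  rewrite !sumrB exch addrC addrA subrK; apply/eqP; rewrite subr_eq0; apply/eqP.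
  by apply: eq_bigr => v _; ring.
move/(psumr_eq0P (fun v _ => addr_ge0 (p1 v) (p2 v))) => eq0.
have both v : y v * (\sum_(u | G v u) x u - lam * x v) = 0 /\
    x v * (lam * y v - \sum_(u | G v u) y u) = 0.
  have /eqP := eq0 v isT; rewrite paddr_eq0 // => /andP[/eqP-> /eqP->].
  by [].
split=> v; case: (both v) => /eqP e1 /eqP e2.
  by move: e1; rewrite mulf_eq0 gt_eqF //= subr_eq0 => /eqP.
by move: e2; rewrite mulf_eq0 subr_eq0 => /orP[/eqP|/eqP]; [left|right].
Qed.

Lemma max_entry (R : realFieldType) (T : finType) (x : T -> R) (t : T) :
  exists v, forall u, x u <= x v.
Proof.
have [v _ vmax] := @Order.TotalTheory.arg_maxP _ R T t xpredT x isT.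
by exists v => u; apply: vmax.
Qed.

Section Eigen.
Variables (R : realType) (n : nat) (G : rel 'I_n).
Hypothesis symG : symmetric G.

Lemma mul_adjmx (z : 'rV[R]_n) v : (z *m adjmx R G) 0 v = \sum_(u | G v u) z 0 u.
Proof.
rewrite mxE [RHS]big_mkcond; apply: eq_bigr => u _.
by rewrite mxE symG; case: (G v u); rewrite ?mulr1 ?mulr0.
Qed.

Lemma eigenvalue_of_vec (a : R) (y : 'I_n -> R) (v0 : 'I_n) :
  y v0 != 0 -> (forall v, \sum_(u | G v u) y u = a * y v) -> eigenvalue (adjmx R G) a.
Proof.
move=> y0 eqy; apply/eigenvalueP; exists (\row_v y v).
  apply/rowP => v; rewrite mul_adjmx !mxE -eqy.
  by apply: eq_bigr => u _; rewrite mxE.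
by apply: contra y0 => /eqP/rowP/(_ v0); rewrite !mxE => ->.
Qed.

Lemma eigenvalue_subinvariant (a : R) : eigenvalue (adjmx R G) a ->
  exists x : 'I_n -> R, [/\ forall v, 0 <= x v, exists v, 0 < x v
    & forall v, a * x v <= \sum_(u | G v u) x u].
Proof.
case/eigenvalueP=> z eqz z0; exists (fun v => `|z 0 v|); split=> [v||v] //.
  have [v zv] : exists v, z 0 v != 0.
    apply: contrapT => /forallNP nz; case/negP: z0; apply/eqP/rowP => v.
    by rewrite mxE; apply/eqP/negPn/negP => /nz.
  by exists v; rewrite normr_gt0.
have := mul_adjmx z v; rewrite eqz mxE => e.
apply: (le_trans (y := `|a * z 0 v|)).
  by rewrite normrM ler_wpM2r // ler_norm.
by rewrite e ler_norm_sum.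
Qed.

Lemma eigenvalue_le (a : R) : eigenvalue (adjmx R G) a -> a <= n%:R.
Proof.
case/eigenvalue_subinvariant=> x [x0 [v0 xv0] subx].
have [v vmax] := max_entry x v0.
have xv : 0 < x v by apply: lt_le_trans (vmax v0).
rewrite -(ler_pM2r xv); apply: le_trans (subx v) _.
rewrite big_mkcond /=; apply: (le_trans (y := \sum_(u < n) x v)).
  by apply: ler_sum => u _; case: ifP.
by rewrite sumr_const card_ord mulr_natl.
Qed.

Lemma spec_radius_ge (a : R) : eigenvalue (adjmx R G) a -> a <= spec_radius R G.
Proof.
by move=> ea; apply: ub_le_sup ea; exists n%:R => b; apply: eigenvalue_le.
Qed.

Lemma roots_in_seq (p : {poly R}) : p != 0 -> exists s : seq R, forall a, root p a -> a \in s.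
Proof.
move: {2}(size p) (leqnn (size p)) => m; elim: m p => [|m IH] p.
  by rewrite leqn0 size_poly_eq0 => /eqP->; rewrite eqxx.
move=> szp p0; case: (pselect (exists a, root p a)) => [[a ra]|nr]; last first.
  by exists [::] => a ra; case: nr; exists a.
have /factor_theorem[q eqp] := ra.
have q0 : q != 0 by apply: contraNneq p0 => q0; rewrite eqp q0 mul0r.
have [|//|s rs] := IH q.
  by rewrite -ltnS; apply: leq_trans szp; rewrite eqp size_Mmonic ?monicXsubC // size_XsubC addn2.
exists (a :: s) => b; rewrite eqp rootM root_XsubC inE => /orP[/rs->|->//].
by rewrite orbT.
Qed.

(** The eigenvalues are roots of the characteristic polynomial, hence finitely many; if all were
    below [c], so would be their supremum. *)
Lemma spec_radius_attained (c : R) :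
  0 < c -> c <= spec_radius R G -> exists2 a, c <= a & eigenvalue (adjmx R G) a.
Proof.
move=> c0 cle; apply: contrapT => nex.
have lt a : eigenvalue (adjmx R G) a -> a < c.
  by move=> ea; rewrite ltNge; apply/negP => ca; apply: nex; exists a.
have [s rs] := roots_in_seq (monic_neq0 (char_poly_monic (adjmx R G))).
have [d dc ubd] : exists2 d, d < c & forall a, a \in s -> eigenvalue (adjmx R G) a -> a <= d.
  elim: s {rs} => [|b s [d dc ubd]]; first by exists 0.
  case: (boolP (eigenvalue (adjmx R G) b)) => eb; last first.
    exists d => // a; rewrite inE => /orP[/eqP->|/ubd//]; by rewrite (negPf eb).
  exists (Num.max b d); first by rewrite gt_max lt.
  move=> a; rewrite inE le_max => /orP[/eqP-> _|as_ ea]; first by rewrite lexx.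
  by rewrite ubd ?orbT.
(* The supremum of the empty set is 0 by convention, which [0 < c] excludes. *)
case: (pselect (exists a, eigenvalue (adjmx R G) a)) => [[a ea]|ne]; last first.
  move: cle; rewrite /spec_radius sup_out ?leNgt ?c0 //.
  by case=> -[a ea] _; apply: ne; exists a.
suff : spec_radius R G <= d by move=> h; move: (le_lt_trans (le_trans cle h) dc); rewrite ltxx.
apply: ge_sup; first by exists a.
by move=> b eb; apply: ubd => //; apply: rs; rewrite -eigenvalue_root_char.
Qed.
End Eigen.

(** * Suspended graphs *)

Section Pendant.
Variables (R : realFieldType) (T : finType) (B : {set T}) (c : T -> bool) (att : T -> T).
Hypotheses (attB : forall v, att v \in B) (attid : {in B, att =1 id}).

(* The largest graph consisting of a bipartite graph on B with colouring c and,
   at each b in B, graphs suspended on b whose other vertices are att^-1(b) \ B. *)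
Definition full : rel T := fun u v =>
  [&& u \in B, v \in B & c u != c v] || ((att u == att v) && (u != v)).

Definition pend (b : T) : nat := #|[set w | (w \notin B) && (att w == b)]|.

(* Eliminating a clique of t vertices suspended on b from the eigenvalue equation
   makes b count as 1 + gain lam t vertices of its class, so that the eigenvalue
   equation of full becomes lam^2 = eff lam false * eff lam true. *)
Definition gain (lam : R) (t : nat) : R := t%:R / ((lam + 1) * (lam - t%:R)).

Definition eff (lam : R) (d : bool) : R := \sum_(v | (v \in B) && (c v == d)) (1 + gain lam (pend v)).

(** Solution of the eigenvalue equations around a vertex b of [B] with t suspended vertices of
    common weight z: (lam - t + 1) z = y_b and lam y_b = lam wt + t z, where lam wt stands for the
    sum over the neighbours of b in [B]. *)
Definition pweight (lam : R) (wt : bool -> R) (v : T) : R :=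
  if v \in B then wt (c v) * (1 + gain lam (pend v))
  else wt (c (att v)) * (lam / ((lam + 1) * (lam - (pend (att v))%:R))).

Lemma full_sym : symmetric full.
Proof. by move=> u v; rewrite /full andbCA (eq_sym (c u)) (eq_sym (att u)) (eq_sym u). Qed.

Variables (lam : R) (wt : bool -> R).
Hypotheses (lam0 : 0 < lam) (lamt : forall v, (pend v)%:R < lam).

Lemma gain_ge0 v : 0 <= gain lam (pend v).
Proof.
by rewrite divr_ge0 // mulr_ge0 // ?subr_ge0 ?ltW // addr_gt0.
Qed.

Lemma pweight_gt0 v : (forall b, 0 < wt b) -> 0 < pweight lam wt v.
Proof.
move=> wt0; rewrite /pweight; case: ifP => _; rewrite mulr_gt0 //.
  by rewrite ltr_wpDr ?gain_ge0.
by rewrite divr_gt0 // mulr_gt0 // ?subr_gt0 // addr_gt0.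
Qed.

Lemma full_sum_base v : v \in B ->
  \sum_(u | full v u) pweight lam wt u =
  wt (~~ c v) * eff lam (~~ c v) + lam * wt (c v) * gain lam (pend v).
Proof.
move=> vB; rewrite (bigID (mem B)) /=; congr (_ + _).
  rewrite /eff mulr_sumr; apply: eq_big => [u|u]; rewrite /full vB /=.
    case: (boolP (u \in B)) => uB; rewrite ?andbF //= ?andbT !attid //.
    by rewrite andbN orbF; case: (c v); case: (c u).
  case/andP=> /orP[/andP[uB cu]|/andP[vu nvu]] uB'; rewrite /pweight uB'.
    by have -> : c u = ~~ c v by move: cu; case: (c u) (c v) => [] [].
  by move: vu nvu; rewrite !attid // => ->.
rewrite (eq_bigl (fun u => u \in [set w | (w \notin B) && (att w == v)])); last first.
  move=> u; rewrite inE /full vB attid //=.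
  case: (boolP (u \in B)) => uB; rewrite ?andbF //= andbT eq_sym.
  by case: eqP => //= _; apply: contraNneq uB => <-.
rewrite (eq_bigr (fun=> wt (c v) * (lam / ((lam + 1) * (lam - (pend v)%:R))))); last first.
  by move=> u; rewrite inE /pweight => /andP[/negPf-> /eqP->].
by rewrite sumr_const -/(pend v) /gain -[LHS]mulr_natr; ring.
Qed.

Lemma full_sum_pendant v : v \notin B ->
  \sum_(u | full v u) pweight lam wt u = lam * pweight lam wt v.
Proof.
move=> vB; set b := att v.
have bB : b \in B by apply: attB.
rewrite (bigID (mem B)) /= (big_pred1 b); last first.
  move=> u; rewrite /full (negPf vB) /=; case: (boolP (u \in B)) => uB; rewrite ?andbF.
    rewrite andbT (attid uB) eq_sym -/b; case: eqP => //= ->.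
    by apply: contraNneq vB => ->.
  by apply/esym/negbTE; apply: contraNneq uB => ->.
rewrite (eq_bigl (fun u => u \in [set w | (w \notin B) && (att w == b)] :\ v)); last first.
  move=> u; rewrite !inE /full (negPf vB) /= (eq_sym (att u)) (eq_sym u) -/b.
  by case: (u \in B); case: (b == _); case: (v == u).
rewrite (eq_bigr (fun=> pweight lam wt v)); last first.
  by move=> u; rewrite !inE /pweight (negPf vB) => /and3P[_ /negPf-> /eqP->].
rewrite sumr_const.
have cD : (#|[set w | (w \notin B) && (att w == b)] :\ v|.+1 = pend b)%N.
  by rewrite /pend (cardsD1 v [set w | _]) !inE vB eqxx.
rewrite -mulr_natl; set m := #|_|; have -> : m%:R = (pend b)%:R - 1 :> R.
  by rewrite -cD -addn1 natrD addrK.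
rewrite /pweight bB (negPf vB) /gain -/b.
have := lamt b; have := lam0; rewrite -subr_gt0 => l0; rewrite -subr_gt0 => lt.
field; by rewrite !gt_eqF // addr_gt0.
Qed.

End Pendant.

(** * Rigidity of the completed graph *)

Section Rigidity.
Variables (R : realFieldType) (T : finType) (B : {set T}) (c : T -> bool) (att : T -> T).
Hypotheses (attB : forall v, att v \in B) (attid : {in B, att =1 id}).
Hypothesis color : forall d, exists2 v, v \in B & c v = d.
Variables (G : rel T) (lam : R) (x : T -> R).
Hypotheses (symG : symmetric G) (Gfull : forall u v, G u v -> full B c att u v).
Hypothesis Wlam : (#|~: B|)%:R < lam.
Hypotheses (x0 : forall v, 0 <= x v) (xpos : exists v, 0 < x v)
  (subx : forall v, lam * x v <= \sum_(u | G v u) x u).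

Let lam0 : 0 < lam. Proof. exact: le_lt_trans Wlam. Qed.

Lemma pend_lam v : (pend B att v)%:R < lam.
Proof.
apply: le_lt_trans Wlam; rewrite ler_nat; apply/subset_leq_card/fintype.subsetP => w.
by rewrite !inE => /andP[].
Qed.

(** With this normalisation the eigenvalue equation of [full] is exact outside [B] and at colour
    [false]; all slack sits at colour [true], where it is the slack of [effle]. *)
Let wt (d : bool) : R := if d then 1 else eff B c att lam true / lam.
Let y := pweight B c att lam wt.

Lemma eff_gt0 d : 0 < eff B c att lam d.
Proof.
have [v vB cv] := color d; rewrite /eff (bigD1 v) ?vB ?cv ?eqxx //=.
rewrite ltr_wpDr ?sumr_ge0 //; first by move=> u _; rewrite addr_ge0 // gain_ge0 // => w; apply: pend_lam.
by rewrite ltr_wpDr // gain_ge0 // => w; apply: pend_lam.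
Qed.

Hypothesis effle : eff B c att lam false * eff B c att lam true <= lam ^+ 2.

Let wt0 d : 0 < wt d.
Proof. by case: d => //=; rewrite divr_gt0 // eff_gt0. Qed.

Let y0 v : 0 < y v.
Proof. by apply: pweight_gt0 => // u; apply: pend_lam. Qed.

Let fully v : v \in B -> \sum_(u | full B c att v u) y u
  = lam * y v + (wt (~~ c v) * eff B c att lam (~~ c v) - lam * wt (c v)).
Proof.
by move=> vB; rewrite /y full_sum_base // /pweight vB; ring.
Qed.

Let fullle v : \sum_(u | full B c att v u) y u <= lam * y v.
Proof.
case: (boolP (v \in B)) => vB; last first.
  by rewrite /y full_sum_pendant // => u; apply: pend_lam.
rewrite fully // gerDl subr_le0 /wt; case: (c v) => /=.
  by rewrite mulr1 mulrAC ler_pdivrMr // -expr2 mulrC.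
by rewrite mul1r mulrCA divff ?mulr1 // gt_eqF.
Qed.

Let leG v : \sum_(u | G v u) y u <= \sum_(u | full B c att v u) y u.
Proof.
rewrite [leRHS](bigID (G v)) /=.
rewrite (eq_bigl (G v)) => [|u].
  by rewrite lerDl sumr_ge0 // => u _; apply: ltW.
by case: (boolP (G v u)) => [/Gfull->|]; rewrite ?andbF.
Qed.

Let tight := sub_super_tight symG x0 y0 subx (fun v => le_trans (leG v) (fullle v)).

(** Strict slack makes [x] vanish on colour [true]. At a maximum of [x], at most [#|~: B|]
    neighbours then contribute, which is fewer than [lam]. *)
Lemma eff_lt_absurd : eff B c att lam false * eff B c att lam true < lam ^+ 2 -> False.
Proof.
move=> lt; have [eqx dich] := tight.
have xt v : v \in B -> c v -> x v = 0.
  move=> vB cv; case: (dich v) => // eqy; exfalso.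
  have := leG v; rewrite eqy fully // cv /wt /= mulr1.
  rewrite lerDl subr_ge0 leNgt => /negP; apply.
  by rewrite mulrAC ltr_pdivrMr // -expr2 mulrC.
have [v1 xv1] := xpos; have [v vmax] := max_entry x v1.
have xv : 0 < x v by apply: lt_le_trans (vmax v1).
pose a := if v \in B then v else att v.
suff : lam * x v <= (#|~: B|)%:R * x v by rewrite ler_pM2r // leNgt Wlam.
have bd (P : pred T) : \sum_(u | P u) x u <= (#|P|)%:R * x v.
  by rewrite mulr_natl -sumr_const; apply: ler_sum => u _.
rewrite eqx; case: (boolP (v \in B)) => vB.
  have cv : ~~ c v by apply: contraTN xv => /(xt v vB)->; rewrite ltxx.
  rewrite (bigID (mem B)) /= big1 ?add0r => [|u /andP[/Gfull]].
    apply: le_trans (bd _) _; rewrite ler_pM2r // ler_nat.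
    by apply/subset_leq_card/fintype.subsetP => u; rewrite !inE => /andP[].
  case/orP=> [/and3P[_ uB cvu] _|/andP[/eqP vu nvu] uB].
    by apply: xt => //; move: cvu cv; case: (c v) (c u) => [] [].
  by move: vu nvu; rewrite !attid // => ->; rewrite eqxx.
apply: le_trans (bd _) _; rewrite ler_pM2r // ler_nat.
have -> : #|~: B| = #|att v |: (~: B :\ v)|.
  by rewrite cardsU1 !inE attB andbF add1n (cardsD1 v (~: B)) inE vB.
apply/subset_leq_card/fintype.subsetP => u; rewrite !inE => /Gfull.
rewrite /full (negPf vB) /= (eq_sym u v) => /andP[/eqP-> nvu]; rewrite eq_sym nvu /=.
by case: (boolP (u \in B)) => uB; rewrite ?orbT // attid // eqxx.
Qed.

(** Where [x] is positive, the sums of the positive vector [y] over the neighbours in [G] and in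
    [full] agree, so the neighbourhoods agree. The support of [x] therefore spreads along the edges
    of [full], which is connected because both colours occur. *)
Lemma tight_full : G =2 full B c att.
Proof.
have [eqx dich] := tight.
have [e|ne] := eqVneq (eff B c att lam false * eff B c att lam true) (lam ^+ 2); last first.
  by case: eff_lt_absurd; rewrite lt_neqAle ne.
have fulle v : \sum_(u | full B c att v u) y u = lam * y v.
  case: (boolP (v \in B)) => vB; last first.
    by rewrite /y full_sum_pendant // => u; apply: pend_lam.
  rewrite fully // -[RHS]addr0; congr (_ + _); apply/eqP; rewrite subr_eq0 /wt.
  case: (c v) => /=; last by rewrite mul1r mulrCA divff ?mulr1 // gt_eqF.
  by rewrite mulrAC mulr1 [X in X / _]mulrC e expr2 mulfK // gt_eqF.
have nbrG v : 0 < x v -> G v =1 full B c att v.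
  move=> xv u; case: (dich v) => [xv0|eqy]; first by rewrite xv0 ltxx in xv.
  apply/idP/idP => [/Gfull//|fvu]; apply: contraT => nG.
  move: (fulle v); rewrite -eqy (bigID (G v)) /= (eq_bigl (G v)) => [|z]; last first.
    by case: (boolP (G v z)) => [/Gfull->|]; rewrite ?andbF.
  rewrite -[RHS]addr0 => /addrI /(psumr_eq0P (fun z _ => ltW (y0 z))) => /(_ u).
  by rewrite fvu nG => /(_ isT) yu; have := y0 u; rewrite yu ltxx.
have spread v u : 0 < x v -> full B c att v u -> 0 < x u.
  move=> xv fvu; have Guv : G u v by rewrite symG nbrG.
  have : 0 < lam * x u.
    rewrite eqx (bigD1 v) //= ltr_pwDl // sumr_ge0 //.
  by rewrite pmulr_rgt0.
have [v1 xv1] := xpos.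
have xb0 : 0 < x (att v1).
  case: (boolP (v1 \in B)) => vB; first by rewrite attid.
  apply: spread xv1 _; rewrite /full (attid (attB v1)) eqxx /=.
  by rewrite orbC; apply/orP; left; apply: contraNneq vB => ->.
have xB u v : u \in B -> v \in B -> 0 < x u -> c u != c v -> 0 < x v.
  by move=> uB vB xu cuv; apply: spread xu _; rewrite /full uB vB cuv.
have xallB v : v \in B -> 0 < x v.
  move=> vB; have [u uB cu] := color (~~ c (att v1)).
  have xu : 0 < x u by apply: xB xb0 _; rewrite ?cu //; case: (c _).
  have [cv|cv] := eqVneq (c v) (c (att v1)).
    by apply: xB xu _; rewrite // cu cv; case: (c _).
  by apply: xB xb0 _; rewrite // eq_sym.
move=> v u; apply: nbrG.
case: (boolP (v \in B)) => [/xallB//|vB].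
apply: spread (xallB _ (attB v)) _; rewrite /full (attid (attB v)) eqxx /=.
by rewrite orbC; apply/orP; left; apply: contraNneq vB => <-.
Qed.

End Rigidity.

(** * Estimates of [gain] and [eff] *)

Lemma gain_lt (R : realFieldType) (lam C : R) (s : nat) :
  0 <= lam -> s%:R < lam -> s%:R < C * ((lam + 1) * (lam - s%:R)) -> gain lam s < C.
Proof.
by move=> l0 sl h; rewrite /gain ltr_pdivrMr // mulr_gt0 ?subr_gt0 // ltr_wpDl.
Qed.

(** Equivalently (1 + gain s)(1 + gain t) < 1 + gain (s + t). The product term appears when the
    suspended vertices are split between the two classes. *)
Lemma gain_super (R : realFieldType) (lam : R) (s t : nat) : (0 < s)%N -> (0 < t)%N ->
  (s + t)%:R < lam -> gain lam s + gain lam t + gain lam s * gain lam t < gain lam (s + t).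
Proof.
rewrite /gain natrD -(ltr0n R) -(ltr0n R t); set S := s%:R; set U := t%:R => s0 t0 stl.
have D0 : 0 < lam + 1 by lra.
have a0 : 0 < lam - S by lra.
have b0 : 0 < lam - U by lra.
have w0 : 0 < lam - (S + U) by lra.
rewrite -subr_gt0.
have -> : (S + U) / ((lam + 1) * (lam - (S + U))) -
   (S / ((lam + 1) * (lam - S)) + U / ((lam + 1) * (lam - U)) +
    S / ((lam + 1) * (lam - S)) * (U / ((lam + 1) * (lam - U)))) =
   S * U * ((lam + 1) * (lam - U) + (lam + 1) * (lam - S) - (lam - (S + U))) /
   ((lam + 1) ^+ 2 * (lam - S) * (lam - U) * (lam - (S + U))).
  by field; rewrite !gt_eqF.
by rewrite divr_gt0 ?mulr_gt0 ?exprn_gt0 //; nra.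
Qed.

Section EffBound.
Variables (R : realFieldType) (T : finType) (B : {set T}) (c : T -> bool) (att : T -> T).
Hypotheses (attB : forall v, att v \in B).

Definition cls (d : bool) : {set T} := [set v in B | c v == d].
Definition pendsum (d : bool) : nat := (\sum_(v in cls d) pend B att v)%N.

Lemma card_cls : (#|cls false| + #|cls true|)%N = #|B|.
Proof.
rewrite -(cardsID [set v | c v == false] B); congr (_ + _)%N; apply: eq_card => v; rewrite !inE //.
by rewrite andbC; case: (c v).
Qed.

Lemma sum_pend : (\sum_(v in B) pend B att v)%N = #|~: B|.
Proof.
rewrite -[RHS]sum1_card [RHS](partition_big att (mem B)) /=; last by move=> v _; apply: attB.
by apply: eq_bigr => b _; rewrite /pend -sum1_card; apply: eq_bigl => w; rewrite !inE.
Qed.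

Lemma pendsumE : (pendsum false + pendsum true)%N = #|~: B|.
Proof.
rewrite -sum_pend.
rewrite [RHS](bigID (fun v => c v == false)) /=; congr (_ + _)%N.
  by apply: eq_bigl => v; rewrite !inE.
by apply: eq_bigl => v; rewrite !inE; case: (c v).
Qed.

Variable lam : R.
Hypothesis Wlam : (#|~: B|)%:R < lam.

Lemma pendsum_lam d : (pendsum d)%:R < lam.
Proof.
apply: le_lt_trans Wlam; rewrite ler_nat -pendsumE.
by case: d; rewrite ?leq_addr ?leq_addl.
Qed.

Lemma pend_pendsum d v : v \in cls d -> (pend B att v <= pendsum d)%N.
Proof. by move=> vd; rewrite /pendsum (bigD1 v) //= leq_addr. Qed.

Lemma effE d : eff B c att lam d = (#|cls d|)%:R + \sum_(v in cls d) gain lam (pend B att v).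
Proof.
rewrite /eff big_split /= sumr_const; congr (_ + _).
  by congr (_%:R); apply: eq_card => v; rewrite !inE.
by apply: eq_bigl => v; rewrite !inE.
Qed.

Let lam0 : 0 < lam. Proof. exact: le_lt_trans Wlam. Qed.

(** In the denominator of each [gain], the number of vertices suspended at v is replaced by the
    total of the class. This makes the bound linear in those numbers, and it is exact only when each
    of them is 0 or the total, that is, when one vertex carries everything. *)
Lemma eff_le d : eff B c att lam d <= (#|cls d|)%:R + gain lam (pendsum d) ?= iff
  ((pendsum d == 0%N) || [exists v in cls d, pend B att v == pendsum d]).
Proof.
rewrite effE; have tl := pendsum_lam d.
have step v : v \in cls d ->
    gain lam (pend B att v) <= (pend B att v)%:R / ((lam + 1) * (lam - (pendsum d)%:R))
    ?= iff ((pend B att v == 0%N) || (pend B att v == pendsum d)).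
  move=> vd; have le := pend_pendsum vd.
  have [->|p0] := eqVneq (pend B att v) 0%N; first by rewrite /gain !mul0r; split; rewrite ?lexx ?eqxx.
  have pos : 0 < (pend B att v)%:R :> R by rewrite ltr0n lt0n.
  have [->|ne] := eqVneq (pend B att v) (pendsum d); first by rewrite /gain orbT; split; rewrite ?lexx ?eqxx.
  have lt : (pend B att v)%:R < (pendsum d)%:R :> R by rewrite ltr_nat ltn_neqAle ne.
  suff h : gain lam (pend B att v) < (pend B att v)%:R / ((lam + 1) * (lam - (pendsum d)%:R)).
    by split; [apply: ltW | rewrite lt_eqF].
  rewrite /gain ltr_pM2l //.
  rewrite ltf_pV2 ?posrE ?mulr_gt0 ?subr_gt0 ?addr_gt0 //; last by apply: lt_trans tl.
  by rewrite ltr_pM2l ?addr_gt0 // ltrD2l ltrN2.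
have all := leif_sum step; rewrite -mulr_suml -natr_sum in all.
rewrite -/(pendsum d) -/(gain lam (pendsum d)) in all.
split; first by rewrite lerD2l all.1.
rewrite (inj_eq (addrI _)) all.2; apply/idP/idP.
  move/forall_inP => h; have [//|t0] := eqVneq (pendsum d) 0%N.
  have [v vd pv] : exists2 v, v \in cls d & pend B att v != 0%N.
    apply: contrapT => /forall2NP nex; case/negP: t0; rewrite /pendsum big1 // => v vd.
    by case: (nex v) => // /negP; rewrite negbK => /eqP.
  by apply/exists_inP; exists v => //; have := h v vd; rewrite (negPf pv).
case/orP=> [/eqP t0|/exists_inP[v vd /eqP pv]]; apply/forall_inP => u ud.
  by have := pend_pendsum ud; rewrite t0 leqn0 => ->.
have [->|nuv] := eqVneq u v; first by rewrite pv eqxx orbT.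
have : (pend B att v + pend B att u <= pendsum d)%N.
  rewrite /pendsum (bigD1 v) //= (bigD1 u) /= ?ud //.
  by rewrite leq_add2l leq_addr.
by rewrite pv -[X in (_ <= X)%N]addn0 leq_add2l leqn0 => ->.
Qed.
End EffBound.

(** * The number and position of the suspended vertices *)

Lemma prod_le_balanced (p q a b : nat) :
  (p + q = a + b)%N -> (a <= b <= a.+1)%N ->
  [\/ p = a /\ q = b, p = b /\ q = a | (p * q < a * b)%N].
Proof.
move=> e h.
have [pa|pa] := eqVneq p a; first by constructor 1; lia.
have [pb|pb] := eqVneq p b; first by constructor 2; lia.
constructor 3; nia.
Qed.

Lemma prod_le_square (R : realFieldType) (x y z : R) :
  x + y <= z -> 0 <= x -> 0 <= y -> 4 * (x * y) <= z ^+ 2.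
Proof.
move=> h x0 y0; apply: (le_trans (y := (x + y) ^+ 2)).
  by rewrite -subr_ge0 (_ : _ - _ = (x - y) ^+ 2) ?sqr_ge0 //; ring.
by rewrite lerXn2r // nnegrE ?addr_ge0 // (le_trans _ h) // addr_ge0.
Qed.

Section Dichotomy.
Variables (R : realFieldType) (n k r : nat) (T : finType) (B : {set T}) (c : T -> bool) (att : T -> T).
Hypothesis cardT : #|T| = n.
Hypotheses (attB : forall v, att v \in B) (attid : {in B, att =1 id}).
Hypothesis color : forall d, exists2 v, v \in B & c v = d.
Variables (G : rel T) (lam : R) (x : T -> R).
Hypotheses (symG : symmetric G) (Gfull : forall u v, G u v -> full B c att u v).
Hypotheses (x0 : forall v, 0 <= x v) (xpos : exists v, 0 < x v)
  (subx : forall v, lam * x v <= \sum_(u | G v u) x u).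
Hypotheses (k2 : (2 <= k)%N) (r2k : (3 <= r <= 2 * k)%N) (nk : (712 * k <= n)%N).
Hypothesis smallW : (20 * #|~: B| <= n)%N.
Hypothesis lamn : 498 * n%:R <= 1000 * lam.

Let m := (n - r + 1)%N.
Let a := m./2.
Let b := (m - a)%N.
Hypothesis lam2 : a%:R * b%:R + b%:R * gain lam (r - 1) <= lam ^+ 2.

Let ab : (a <= b <= a.+1)%N.
Proof. by have := odd_double_half m; rewrite /b -/a; case: (odd m) => /= h; nlia. Qed.

Let n0 : 1424 <= n%:R :> R.
Proof. by rewrite (ler_nat R 1424); nlia. Qed.


Let lampos : 0 < lam. Proof. have := n0; have := lamn; lra. Qed.

Let wR : (#|~: B|)%:R * 20 <= n%:R :> R.
Proof. by rewrite -natrM ler_nat mulnC. Qed.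

Let Wlam : (#|~: B|)%:R < lam.
Proof. by have := wR; have := n0; have := lamn; lra. Qed.

Let rR : 356 * (r - 1)%:R <= n%:R :> R.
Proof. by rewrite -(natrM R 356) ler_nat; nlia. Qed.

Let mab : m = (a + b)%N.
Proof. by have := odd_double_half m; rewrite /b -/a; nlia. Qed.

Let gain0 u : u%:R < lam -> 0 <= gain lam u.
Proof. by move=> ul; rewrite divr_ge0 // mulr_ge0 // ?subr_ge0 ?ltW // addr_gt0. Qed.

Let gain_tiny u : (u <= r - 1)%N -> n%:R * gain lam u < 1 / 20.
Proof.
rewrite -(ler_nat R) => uw.
have [[rr nn] ll] := (rR, n0, lamn).
have ul : u%:R < lam by lra.
rewrite mulrC -ltr_pdivlMr; last by lra.
apply: gain_lt; [lra|lra|]; rewrite mulrAC ltr_pdivlMr; last by lra.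
have h : n%:R * n%:R * (2 / 10) <= (lam + 1) * (lam - u%:R) by nra.
by nra.
Qed.

Let good := exists2 b0, b0 \in B & pend B att b0 = (r - 1)%N /\ #|cls B c (c b0)| = a.

(** With all [r - 1] vertices suspended at the class of size a the product is at most (a + gain) b,
    the bound of [lam2]. With all at the other class it is at most a (b + gain), which reaches that
    bound only if a = b. A proper split is strictly worse by [gain_super]. *)
Lemma balanced_case d : #|~: B| = (r - 1)%N -> #|cls B c d| = a -> #|cls B c (~~ d)| = b ->
  eff B c att lam d * eff B c att lam (~~ d) <= lam ^+ 2 /\
  (eff B c att lam d * eff B c att lam (~~ d) = lam ^+ 2 -> good).
Proof.
move=> wr pa qb.
have [le0 eq0] := eff_le c attB Wlam d.
have [le1 eq1] := eff_le c attB Wlam (~~ d).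
have eg d' := eff_gt0 att color Wlam d'.
have swt : (pendsum B c att d + pendsum B c att (~~ d) = r - 1)%N.
  by rewrite -wr -(pendsumE c attB); case: d {pa qb le0 eq0 le1 eq1} => //=; rewrite addnC.
rewrite pa in le0 eq0; rewrite qb in le1 eq1.
have inc d' v : v \in cls B c d' -> v \in B /\ c v = d'.
  by rewrite inE => /andP[-> /eqP].
set s := pendsum B c att d in le0 eq0 swt; set t := pendsum B c att (~~ d) in le1 eq1 swt.
set e := eff B c att lam d in le0 eq0 *; set f := eff B c att lam (~~ d) in le1 eq1 *.
have e0 : 0 < e by apply: eg.
have f0 : 0 < f by apply: eg.
have b1 : 1 <= b%:R :> R by rewrite (ler_nat R 1); move: nk k2 r2k ab; rewrite /b /m; nlia.
have ableR : a%:R <= b%:R :> R by rewrite ler_nat; case/andP: ab.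
have a0 : 0 <= a%:R :> R by apply: ler0n.
have gw0 : 0 < gain lam (r - 1).
  have r1 : 0 < (r - 1)%:R :> R by rewrite ltr0n; nlia.
  by apply: divr_gt0 => //; apply: mulr_gt0; [apply: addr_gt0 | rewrite subr_gt0 -wr].
have l2 := lam2; have abg : a%:R * gain lam (r - 1) <= b%:R * gain lam (r - 1).
  by rewrite ler_wpM2r // ltW.
have [s0|s0] := posnP s.
  have ts : t = (r - 1)%N by nlia.
  have gs : gain lam s = 0 by rewrite s0 /gain mul0r.
  rewrite gs addr0 in le0; rewrite ts in le1 eq1.
  have h1 : e * f <= a%:R * (b%:R + gain lam (r - 1)) by rewrite ler_pM // ltW.
  split; first by lra.
  move=> eqef; have eqf : f = b%:R + gain lam (r - 1).
    apply/eqP; rewrite eq_le le1 leNgt; apply/negP => lt.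
    have h2 : e * f <= a%:R * f by rewrite ler_pM2r.
    have : a%:R * f < a%:R * (b%:R + gain lam (r - 1)) by rewrite ltr_pM2l // (lt_le_trans e0).
    by lra.
  have aeb : a = b.
    have [ab1 _] := andP ab; move: ab1; rewrite leq_eqVlt => /orP[/eqP//|alb]; exfalso.
    have : a%:R * gain lam (r - 1) < b%:R * gain lam (r - 1) by rewrite ltr_pM2r // ltr_nat.
    by lra.
  move/esym: eq1; rewrite eqf eqxx => /orP[/eqP|/exists_inP[v vd /eqP pv]]; first by nlia.
  by have [vB cv] := inc _ _ vd; exists v => //; rewrite cv qb aeb pv.
have [t0|t0] := posnP t.
  have ss : s = (r - 1)%N by nlia.
  have gt : gain lam t = 0 by rewrite t0 /gain mul0r.
  rewrite gt addr0 in le1; rewrite ss in le0 eq0.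
  have h1 : e * f <= (a%:R + gain lam (r - 1)) * b%:R by rewrite ler_pM // ltW.
  split; first by lra.
  move=> eqef; have eqe : e = a%:R + gain lam (r - 1).
    apply/eqP; rewrite eq_le le0 leNgt; apply/negP => lt.
    have h2 : e * f <= e * b%:R by rewrite ler_pM2l.
    have : e * b%:R < (a%:R + gain lam (r - 1)) * b%:R by rewrite ltr_pM2r //; lra.
    by lra.
  move/esym: eq0; rewrite eqe eqxx => /orP[/eqP|/exists_inP[v vd /eqP pv]]; first by nlia.
  by have [vB cv] := inc _ _ vd; exists v => //; rewrite cv pa pv.
have stl : (s + t)%:R < lam by rewrite swt -wr.
have sup := gain_super s0 t0 stl; rewrite swt in sup.
have gs : 0 <= gain lam s.
  by apply: gain0; apply: le_lt_trans stl; rewrite ler_nat leq_addr.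
have gt : 0 <= gain lam t.
  by apply: gain0; apply: le_lt_trans stl; rewrite ler_nat leq_addl.
have h1 : e * f <= (a%:R + gain lam s) * (b%:R + gain lam t) by rewrite ler_pM // ltW.
have h2 : (a%:R + gain lam s) * (b%:R + gain lam t) <=
    a%:R * b%:R + b%:R * (gain lam s + gain lam t + gain lam s * gain lam t).
  have : 0 <= (b%:R - a%:R) * gain lam t by rewrite mulr_ge0 // subr_ge0.
  have : 0 <= (b%:R - 1) * (gain lam s * gain lam t) by rewrite mulr_ge0 ?subr_ge0 // mulr_ge0.
  by nra.
have h3 : b%:R * (gain lam s + gain lam t + gain lam s * gain lam t) < b%:R * gain lam (r - 1).
  by rewrite ltr_pM2l //; lra.
have lt : e * f < lam ^+ 2 by lra.
by split=> [|eqef]; [apply: ltW | rewrite eqef ltxx in lt].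
Qed.

Lemma pendant_dichotomy : (#|~: B| <= r - 2)%N \/
  [/\ G =2 full B c att, #|~: B| = (r - 1)%N & good].
Proof.
have [|wr] := leqP #|~: B| (r - 2); first by left.
right.
have [le0 eq0] := eff_le c attB Wlam false.
have [le1 eq1] := eff_le c attB Wlam true.
have eg d' := eff_gt0 att color Wlam d'.
have strict h := eff_lt_absurd attB attid color symG Gfull Wlam x0 xpos subx (ltW h) h.
have swt := pendsumE c attB.
have pqn : (#|cls B c false| + #|cls B c true| + #|~: B| = n)%N.
  rewrite card_cls -cardT -(cardC (mem B)); congr (_ + _)%N.
  by apply: eq_card => v; rewrite !inE.
have [p0 q0] : 0 <= (#|cls B c false|)%:R :> R /\ 0 <= (#|cls B c true|)%:R :> R by split; apply: ler0n.
have plt d : (pendsum B c att d <= #|~: B|)%N.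
  by rewrite -swt; case: d; rewrite ?leq_addr ?leq_addl.
have g0 d : 0 <= gain lam (pendsum B c att d) by apply: gain0; apply: (pendsum_lam c attB Wlam).
have [h0 h1] := (g0 false, g0 true).
have gw0 : 0 <= gain lam (r - 1) by apply: gain0; have := rR; have := n0; have := lamn; lra.
have ab0 : 0 <= b%:R * gain lam (r - 1) by rewrite mulr_ge0.
have [wr1|wneq] := eqVneq #|~: B| (r - 1)%N; last first.
  exfalso; apply: strict.
  have l2 := lam2; have wge : (r <= #|~: B|)%N by move/eqP: wneq wr; nlia.
  (* At least r vertices lie outside [B], so the class sizes sum to at most m - 1. The gains raise
     this to at most m - 3/4, too little against m^2 <= 4 a b + 1. *)
  have gsmall d : gain lam (pendsum B c att d) < 1 / 8.
    have uw : (pendsum B c att d)%:R <= (#|~: B|)%:R :> R by rewrite ler_nat plt.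
    have [[wn nn] ll] := (wR, n0, lamn).
    apply: gain_lt; [lra|lra|].
    have h : n%:R * n%:R * (2 / 10) <= (lam + 1) * (lam - (pendsum B c att d)%:R) by nra.
    by nra.
  have [gs gt] := (gsmall false, gsmall true).
  set e := eff _ _ _ _ _ in le0 *; set f := eff _ _ _ _ _ in le1 *.
  have pqm : (#|cls B c false|)%:R + (#|cls B c true|)%:R <= m%:R - 1 :> R.
    by rewrite lerBrDr -natrD natr1 ler_nat /m; nlia.
  have h : 4 * (e * f) <= (m%:R - 3 / 4) ^+ 2.
    by apply: prod_le_square; rewrite ?ltW ?eg //; lra.
  have mm : m%:R * m%:R <= 4 * (a%:R * b%:R) + 1 :> R.
    have : (m * m <= 4 * (a * b) + 1)%N by move: ab mab; clear; move: m a b => u v z; nia.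
    by rewrite -(ler_nat R) (natrD _ (4 * (a * b))) !(natrM, natrM R 4).
  have m2 : 2 <= m%:R :> R by rewrite (ler_nat R 2) /m; nlia.
  by nra.
have pq : (#|cls B c false| + #|cls B c true| = a + b)%N.
  by move: pqn mab; rewrite wr1 /m; nlia.
have [[pa qb]|[pb qa]|lt] := prod_le_balanced pq ab.
- have [le gd] := @balanced_case false wr1 pa qb.
  split=> //; first by have h := tight_full attB attid color symG Gfull Wlam x0 xpos subx le; exact: h.
  apply: gd; apply/eqP; rewrite eq_le le leNgt; apply/negP => /strict.
  by [].
- have [] := @balanced_case true wr1 qa pb; rewrite /= mulrC => le gd.
  split=> //; first by have h := tight_full attB attid color symG Gfull Wlam x0 xpos subx le; exact: h.
  apply: gd; apply/eqP; rewrite eq_le le leNgt; apply/negP => /strict.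
  by [].
(* Unbalanced classes lose at least 1 in an integer product, whereas each gain contributes less than
   1/20 even when multiplied by n. *)
exfalso; apply: strict; have l2 := lam2.
have gt0 := gain_tiny (leq_trans (plt false) (eq_leq wr1)).
have gt1 := gain_tiny (leq_trans (plt true) (eq_leq wr1)).
set e := eff _ _ _ _ _ in le0 *; set f := eff _ _ _ _ _ in le1 *.
have ltR : (#|cls B c false|)%:R * (#|cls B c true|)%:R + 1 <= a%:R * b%:R :> R.
  by rewrite -!natrM natr1 ler_nat.
have pn : (#|cls B c false|)%:R <= n%:R :> R by rewrite ler_nat; nlia.
have qn : (#|cls B c true|)%:R <= n%:R :> R by rewrite ler_nat; nlia.
have nn := n0.
have h : e * f <= ((#|cls B c false|)%:R + gain lam (pendsum B c att false)) *
                  ((#|cls B c true|)%:R + gain lam (pendsum B c att true)).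
  by rewrite ler_pM // ltW ?eg.
move: h0 h1 gt0 gt1 h pn qn p0 q0 ltR.
set g := gain lam _; set g' := gain lam _; set P := (#|_|)%:R; set Q := (#|_|)%:R.
move=> h0 h1 gt0 gt1 h pn qn p0 q0 ltR.
have k1 : P * g' <= n%:R * g' by rewrite ler_wpM2r.
have k3 : Q * g <= n%:R * g by rewrite ler_wpM2r.
have k4 : g * g' <= n%:R * g' by rewrite ler_wpM2r //; nra.
by nra.
Qed.
End Dichotomy.

(** * Excluding wrong ears: weights *)

Lemma sum_nbr (R : realFieldType) (T : finType) (G : rel T) (A : {set T}) v :
  \sum_(u | G v u) (u \in A)%:R = (#|nbr G A v|)%:R :> R.
Proof.
rewrite -sum1_card natr_sum (bigID (mem A)) /= [X in _ + X]big1 ?addr0; last first.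
  by move=> u /andP[_ /negPf->].
by apply: eq_big => [u|u /andP[_ ->]//]; rewrite !inE andbC.
Qed.

(* S is a bipartite core, M consists of inner vertices of a shortest wrong ear from
   h to h', and O is the rest.  The super-solution gives the vertices of S weight
   about 1, those of O at most 3/4 of that (a vertex of O sees little more than half
   of a side), and those of M weight O(1/n).  The vertices of M are seen only by
   h, h' and the vertices outside S, so they are paid for by the slack demanded
   at h and h'. *)
Lemma ear_weights_absurd (R : realFieldType) (n k o : nat) (T : finType) (G : rel T)
    (S M : {set T}) (H : bool -> {set T}) (c : T -> bool) (h h' : T)
    (lam : R) (x : T -> R) (th : bool -> R) :
  #|T| = n -> symmetric G ->
  (forall v, v \in M -> v \notin S) ->
  (forall d v, v \in H d -> v \in S /\ c v = d) ->
  (forall u v, u \in S -> v \notin M -> G v u -> c u != c v) ->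
  (forall u v, u \in S -> v \in M -> G v u -> (u == h) || (u == h')) ->
  (forall v d, v \in ~: (S :|: M) -> (2 * #|nbr G (H d) v| <= #|H d| + 4 * k)%N) ->
  (20 * #|~: (H false :|: H true)| <= n)%N ->
  (forall d, (4 * n <= 10 * #|H d|)%N) ->
  (#|M| <= 2 * k)%N -> #|~: (S :|: M)| = o.+2 ->
  (2 <= k)%N -> (712 * k <= n)%N ->
  498 * n%:R <= 1000 * lam -> 1000 * lam <= 503 * n%:R ->
  (forall d, (#|H (~~ d)|)%:R <= th d) ->
  th false + th true <= n%:R -> th false * th true < lam ^+ 2 ->
  (forall v, v \in S ->
    (#|nbr G S v|)%:R + 3 / 4 * (#|nbr G (~: (S :|: M)) v|)%:R
    + (if (v == h) || (v == h') then 1 / 4 + o%:R / 50 else 0) <= th (c v)) ->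
  (forall v, 0 <= x v) -> (exists v, 0 < x v) ->
  (forall v, lam * x v <= \sum_(u | G v u) x u) -> False.
Proof.
move=> cardT symG SM HS cG MG OH Hbig H40 M2k; set O := ~: (S :|: M).
move=> cardO k2 nk lam_lo lam_hi thH thn th_lam thS x0 xpos subx.
(* A vertex of [M] sees at most h and h' in [S], the o + 2 vertices of [O], and [M] itself: total
   weight below 5 + o. The factor 49/100 n lies slightly below [lam]. *)
pose nu : R := (5 + o%:R) / (49 / 100 * n%:R).
pose wt (d : bool) : R := if d then 1 else th false / lam.
pose y v : R := if v \in M then nu else (if v \in S then 1 else 3 / 4) * wt (c v).
have n0 : 1424 <= n%:R :> R by rewrite (ler_nat R 1424); nlia.
have kn : 712 * k%:R <= n%:R :> R by rewrite -(natrM R 712) ler_nat.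
have o0 : 0 <= o%:R :> R by apply: ler0n.
have lam0 : 0 < lam by lra.
have Hb d : 4 / 10 * n%:R <= (#|H d|)%:R :> R.
  by have := H40 d; rewrite -(ler_nat R) (natrM R 4) (natrM R 10); lra.
have th_lo d : 4 / 10 * n%:R <= th d by apply: le_trans (Hb _) (thH d).
have [tf tt] := (th_lo false, th_lo true).
have lwt : lam * wt false = th false by rewrite /wt mulrC divfK // gt_eqF.
have wt_lo d : 79 / 100 <= wt d.
  case: d => /=; [by clear; lra | by rewrite ler_pdivlMr //; clear -tf lam_hi n0; lra].
have wt_hi d : wt d <= 121 / 100.
  case: d => /=; [by clear; lra | by rewrite ler_pdivrMr //; clear -tf tt thn lam_lo n0; lra].
have wt_th d : wt (~~ d) * th d <= lam * wt d.
  case: d => /=; last by rewrite mul1r lwt.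
  by rewrite mulr1 mulrAC ler_pdivrMr // -expr2 ltW.
have wt_tht : wt false * th true < lam * wt true.
  by rewrite /wt mulr1 mulrAC ltr_pdivrMr // -expr2.
have oO : (o.+2 <= #|~: (H false :|: H true)|)%N.
  rewrite -cardO; apply/subset_leq_card/fintype.subsetP => v; rewrite !inE !negb_or.
  by case/andP=> vS _; apply/andP; split; apply: contra vS => /HS[].
have oR : (o%:R + 2) * 20 <= n%:R :> R.
  by move: (leq_trans (leq_mul (leqnn 20) oO) Hbig); rewrite -(ler_nat R) (natrM R 20) -(addn2 o) (natrD R o); lra.
have MR : (#|M|)%:R <= 2 * k%:R :> R by rewrite -(natrM R 2) ler_nat.
have M0 : 0 <= (#|M|)%:R :> R by apply: ler0n.
have npos : 0 < 49 / 100 * n%:R :> R by clear -n0; lra.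
have nu0 : 0 < nu by rewrite /nu divr_gt0 // ltr_wpDr // ltr0n.
have nun : nu * (49 / 100 * n%:R) = 5 + o%:R by rewrite /nu divfK // gt_eqF.
have nuM : nu * (#|M|)%:R <= 6 / 1000 * (5 + o%:R).
  rewrite -nun; have h1 : nu * (#|M|)%:R <= nu * (2 * k%:R) by rewrite ler_pM2l.
  have h2 : nu * (712 * k%:R) <= nu * n%:R by rewrite ler_pM2l.
  have h3 : 0 <= nu * n%:R by rewrite mulr_ge0 // ltW.
  by clear -h1 h2 h3; lra.
have nu_hi : nu <= 121 / 100.
  by rewrite ler_pdivrMr //; clear -oR n0; lra.
have wt0 d : 0 < wt d by apply: lt_le_trans (wt_lo d); clear; lra.
have y0 v : 0 < y v.
  by rewrite /y; case: ifP => // _; rewrite mulr_gt0 //; case: ifP => // _; clear; lra.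
have y_hi v : y v <= 121 / 100.
  rewrite /y; case: ifP => // _; apply: (le_trans (y := wt (c v))) => //.
  by apply: ler_piMl; [exact: ltW | case: ifP => _; clear; lra].
have inO v : (v \in O) = (v \notin S) && (v \notin M) by rewrite !inE negb_or.
have split_y v (a b : R) : (forall u, u \in S -> G v u -> y u <= a) ->
    (forall u, u \in O -> G v u -> y u <= b) ->
    \sum_(u | G v u) y u <= a * (#|nbr G S v|)%:R + b * (#|nbr G O v|)%:R + nu * (#|nbr G M v|)%:R.
  move=> ha hb; rewrite -!(sum_nbr R) !mulr_sumr -!big_split /=; apply: ler_sum => u vu.
  case: (boolP (u \in M)) => uM.
    have uS := SM _ uM; rewrite inO uM (negPf uS) /= !mulr0 !add0r mulr1 /y uM.
    exact: lexx.
  case: (boolP (u \in S)) => uS.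
    by rewrite inO uS /= !mulr0 !addr0 mulr1; apply: ha.
  by rewrite inO uS uM /= !mulr0 addr0 add0r mulr1; apply: hb; rewrite // inO uS uM.
have cGO u v : u \in O -> v \in S -> G v u -> c u = ~~ c v.
  rewrite inO => /andP[uS uM] vS vu; have := cG _ _ vS uM; rewrite symG => /(_ vu).
  by case: (c u) (c v) => [] [].
have supS v : v \in S -> \sum_(u | G v u) y u <= wt (~~ c v) * th (c v).
  move=> vS; have vM : v \notin M by apply: contraL vS => /SM.
  have hS u : u \in S -> G v u -> y u <= wt (~~ c v).
    move=> uS vu; have -> : y u = wt (c u) by rewrite /y uS mul1r ifN //; apply: contraL uS => /SM.
    by have := cG _ _ uS vM vu; case: (c u) (c v) => [] [].
  have hO u : u \in O -> G v u -> y u <= 3 / 4 * wt (~~ c v).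
    move=> uO vu; move: (uO); rewrite inO /y => /andP[/negPf-> /negPf->].
    by rewrite (cGO _ _ uO vS vu).
  apply: le_trans (split_y v _ _ hS hO) _.
  have sl : nu * (#|nbr G M v|)%:R <= wt (~~ c v) *
      (if (v == h) || (v == h') then 1 / 4 + o%:R / 50 else 0).
    case: ifP => hh; last first.
      rewrite [nbr G M v](_ : _ = set0) ?cards0 ?mulr0 //; apply/setP => u; rewrite !inE.
      by apply/negP => /andP[uM vu]; have := MG _ _ vS uM; rewrite symG hh => /(_ vu).
    apply: (le_trans (y := nu * (#|M|)%:R)).
      by rewrite ler_pM2l // ler_nat; apply/subset_leq_card/fintype.subsetP => u; rewrite inE => /andP[].
    apply: le_trans nuM _; apply: (le_trans (y := 79 / 100 * (1 / 4 + o%:R / 50))).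
      by clear -o0; lra.
    by rewrite ler_wpM2r //; clear -o0; lra.
  have := thS _ vS; rewrite -(ler_pM2l (wt0 (~~ c v))) !mulrDr => hth.
  by move: sl hth; clear; set X := wt _ * (if _ then _ else _); lra.
have supO v : v \in O -> \sum_(u | G v u) y u < lam * y v.
  move=> vO; move: (vO); rewrite inO => /andP[vS vM].
  have le1 : \sum_(u | G v u) y u <= wt (~~ c v) * (#|nbr G (H (~~ c v)) v|)%:R
      + 121 / 100 * (#|nbr G (~: (H false :|: H true)) v|)%:R.
    rewrite -!(sum_nbr R) !mulr_sumr -!big_split /=; apply: ler_sum => u vu.
    rewrite [in X in _ + X]inE [in X in _ + X]inE.
    case: (boolP (u \in H (~~ c v))) => uH.
      have -> : (u \in H false) || (u \in H true) by move: uH; case: (c v) => /= ->; rewrite ?orbT.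
      have [uS cu] := HS _ _ uH; rewrite mulr0 addr0 mulr1 /y uS mul1r cu ifN //.
      by apply: contraL uS => /SM.
    have -> : (u \in H false) || (u \in H true) = false.
      apply/negP => uHH; have uHv : u \in H (c v).
        by move: uH uHH; case: (c v) => /= /negPf->; rewrite ?orbF.
      by have [uS cu] := HS _ _ uHv; have := cG _ _ uS vM vu; rewrite cu eqxx.
    by rewrite /= mulr0 add0r mulr1.
  apply: le_lt_trans le1 _.
  have -> : lam * y v = 3 / 4 * (lam * wt (c v)).
    by rewrite /y (negPf vM) (negPf vS); clear; ring.
  have hO : 2 * (#|nbr G (H (~~ c v)) v|)%:R <= (#|H (~~ c v)|)%:R + 4 * k%:R :> R.
    by have := OH v (~~ c v) vO; rewrite -(ler_nat R) (natrM R 2) natrD (natrM R 4).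
  have hB : 20 * (#|nbr G (~: (H false :|: H true)) v|)%:R <= n%:R :> R.
    rewrite -(natrM R 20) ler_nat; apply: leq_trans Hbig; rewrite leq_mul2l /=.
    by apply/subset_leq_card/fintype.subsetP => u; rewrite inE => /andP[].
  have h1 := le_trans (ler_wpM2l (ltW (wt0 (~~ c v))) (thH (c v))) (wt_th (c v)).
  have h2 : wt (~~ c v) * (2 * (#|nbr G (H (~~ c v)) v|)%:R) <=
      wt (~~ c v) * ((#|H (~~ c v)|)%:R + 4 * k%:R) by rewrite ler_pM2l.
  have h3 : wt (~~ c v) * k%:R <= 121 / 100 * k%:R by rewrite ler_wpM2r.
  have h4 : lam * (79 / 100) <= lam * wt (c v) by rewrite ler_pM2l.
  by move: h1 h2 h3 h4 hB lam_lo kn n0; rewrite mulrDr; clear; nra.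
have supM v : v \in M -> \sum_(u | G v u) y u < lam * y v.
  move=> vM; have hO u : u \in O -> G v u -> y u <= 3 / 4 * (121 / 100).
    move=> uO vu; move: (uO); rewrite inO /y => /andP[/negPf-> /negPf->].
    by rewrite ler_pM2l //; clear; lra.
  apply: le_lt_trans (split_y v (121 / 100) _ (fun u _ _ => y_hi u) hO) _; rewrite /y vM.
  have s2 : (#|nbr G S v|)%:R <= 2 :> R.
    rewrite (ler_nat R _ 2); apply: leq_trans (_ : #|[set h; h']| <= 2)%N; last by rewrite cards2; case: (_ != _).
    by apply/subset_leq_card/fintype.subsetP => u; rewrite !inE => /andP[uS vu]; apply: MG _ _ uS vM vu.
  have sO : (#|nbr G O v|)%:R <= o%:R + 2 :> R.
    rewrite -natrD ler_nat addn2 -cardO; apply/subset_leq_card/fintype.subsetP => u.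
    by rewrite inE => /andP[].
  have sM : nu * (#|nbr G M v|)%:R <= nu * (#|M|)%:R.
    by rewrite ler_pM2l // ler_nat; apply/subset_leq_card/fintype.subsetP => u; rewrite inE => /andP[].
  have ln : nu * (498 / 1000 * n%:R) <= lam * nu.
    by rewrite mulrC ler_pM2r //; clear -lam_lo; lra.
  by move: s2 sO sM nuM ln nun o0; clear; lra.
have supy v : \sum_(u | G v u) y u <= lam * y v.
  case: (boolP (v \in M)) => vM; first exact/ltW/supM.
  case: (boolP (v \in S)) => vS; last by apply/ltW/supO; rewrite inO vS vM.
  by apply: le_trans (supS v vS) _; rewrite /y (negPf vM) vS mul1r.
have [eqx dich] := sub_super_tight symG x0 y0 subx supy.
have xM v : v \in M -> x v = 0.
  by move=> vM; case: (dich v) => // e; have := supM v vM; rewrite e ltxx.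
have xO v : v \in O -> x v = 0.
  by move=> vO; case: (dich v) => // e; have := supO v vO; rewrite e ltxx.
have xT v : v \in S -> c v -> x v = 0.
  move=> vS cv; case: (dich v) => // e; have := supS v vS; rewrite e cv /=.
  have -> : y v = wt true by rewrite /y vS mul1r cv ifN //; apply: contraL vS => /SM.
  by rewrite leNgt wt_tht.
have [v1] := xpos; suff -> : x v1 = 0 by rewrite ltxx.
case: (boolP (v1 \in M)) => vM; first exact: xM.
case: (boolP (v1 \in S)) => vS; last by apply: xO; rewrite inO vS vM.
case: (boolP (c v1)) => cv; first exact: xT.
(* Only core vertices of colour [false] remain, and [x] vanishes at all their neighbours. *)
have : lam * x v1 = 0.
  rewrite eqx big1 // => u vu.
  case: (boolP (u \in M)) => uM; first exact: xM.
  case: (boolP (u \in S)) => uS; last by apply: xO; rewrite inO uS uM.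
  by apply: xT => //; have := cG _ _ uS vM vu; move: cv; case: (c u) (c v1) => [] [].
by move/eqP; rewrite mulf_eq0 gt_eqF //= => /eqP.
Qed.

Local Close Scope ring_scope.

(** * Existence of the core *)

Section DegreeSum.
Variables (T : finType) (G : rel T).
Hypotheses (symG : symmetric G) (irrG : irreflexive G).

Lemma long_path_in (N : {set T}) (l : nat) (v0 : T) : v0 \in N ->
  {in N, forall u, l <= #|nbr G N u|} ->
  forall j, j <= l -> exists v p, [/\ size p = j, path G v p, uniq (v :: p) & {subset v :: p <= N}].
Proof.
move=> v0N degN; elim=> [_|j IH jl].
  by exists v0, [::]; split=> // u; rewrite inE => /eqP->.
have [v [p [szp pp up sp]]] := IH (ltnW jl).
have vN : v \in N by apply: sp; rewrite mem_head.
have : 0 < #|nbr G N v :\: [set x in p]|.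
  have := cardsID [set x in p] (nbr G N v); have := degN _ vN.
  have : #|nbr G N v :&: [set x in p]| <= size p.
    apply: leq_trans (card_size p); rewrite -[#|mem p|]cardsE.
    by apply/subset_leq_card/subsetIr.
  by rewrite szp; nlia.
case/card_gt0P=> u; rewrite !inE => /and3P[up' uN vu].
exists u, (v :: p); split.
- by rewrite /= szp.
- by rewrite /= symG vu.
- rewrite cons_uniq up andbT inE negb_or up' andbT.
  by apply: contraTneq vu => ->; rewrite irrG.
- by move=> z; rewrite inE => /orP[/eqP->|/sp].
Qed.

(** A weak form of the Erdős-Gallai bound: without a path of l edges, some vertex has fewer than l
    neighbours in [N], and removing it lowers the degree sum by less than 2 l. *)
Lemma degree_sum_le (l : nat) (N : {set T}) :
  (forall v p, size p = l -> path G v p -> uniq (v :: p) -> ~ {subset v :: p <= N}) ->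
  \sum_(u in N) #|nbr G N u| <= 2 * l * #|N|.
Proof.
move: {2}#|N| (leqnn #|N|) => m; elim: m N => [|m IH] N szN noP.
  by move: szN; rewrite leqn0 cards_eq0 => /eqP->; rewrite big_set0.
have [->|[v0 v0N]] := set_0Vmem N; first by rewrite big_set0.
have [u uN du] : exists2 u, u \in N & #|nbr G N u| < l.
  apply: contrapT => /forall2NP nex.
  have degN : {in N, forall u, l <= #|nbr G N u|}.
    by move=> u uN; case: (nex u) => // /negP; rewrite -leqNgt.
  have [v [p [szp pp up sp]]] := long_path_in v0N degN (leqnn l).
  exact: noP szp pp up sp.
have cN : #|N| = #|N :\ u|.+1 by rewrite (cardsD1 u N) uN.
have IH' : \sum_(v in N :\ u) #|nbr G (N :\ u) v| <= 2 * l * #|N :\ u|.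
  apply: IH; first by rewrite -ltnS -cN.
  move=> v p szp pp up sp; apply: (noP v p szp pp up) => z /sp.
  by rewrite inE => /andP[].
have step v : v \in N :\ u -> #|nbr G N v| = #|nbr G (N :\ u) v| + (G u v).
  move=> vN; rewrite (cardsD1 u (nbr G N v)) inE uN symG addnC; congr (_ + _).
  by apply: eq_card => z; rewrite !inE andbA.
rewrite (big_setD1 u uN) /= (eq_bigr _ step) big_split /=.
have -> : \sum_(v in N :\ u) (G u v : nat) = #|nbr G N u|.
  rewrite -sum1_card big_mkcond [RHS]big_mkcond /=; apply: eq_bigr => v _.
  rewrite !inE; case: (eqVneq v u) => [->|_] /=; first by rewrite irrG andbF.
  by case: (v \in N); case: (G u v).
by rewrite cN mulnS; nlia.
Qed.
End DegreeSum.

Local Open Scope ring_scope.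

(* Counts the 2-walks from a vertex v at which x is maximal. *)
Lemma walks2_ge (R : realFieldType) (T : finType) (G : rel T) (lam : R) (x : T -> R) (v : T) :
  0 <= lam -> (forall u, x u <= x v) -> 0 < x v ->
  (forall u, lam * x u <= \sum_(w | G u w) x w) ->
  lam ^+ 2 <= (\sum_(u in nbr G setT v) #|nbr G setT u|)%:R.
Proof.
move=> l0 vmax xv subx; rewrite -(ler_pM2r xv).
have h1 : lam ^+ 2 * x v <= lam * \sum_(u | G v u) x u.
  by rewrite expr2 -mulrA ler_wpM2l.
apply: le_trans h1 _; rewrite mulr_sumr natr_sum mulr_suml.
rewrite [leRHS](eq_bigl (G v)) => [|u]; last by rewrite !inE.
apply: ler_sum => u _; apply: le_trans (subx u) _.
rewrite mulr_natl -sumr_const [leRHS](eq_bigl (G u)) => [|w]; last by rewrite !inE.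
exact: ler_sum.
Qed.

(* D and E are the numbers of neighbours and non-neighbours of v, and mi is the
   number of missing edges between these two sets. *)
Lemma core_arith (R : realFieldType) (n k D E mi lam : R) :
  D + E = n -> 0 <= k -> 712 * k <= n -> 0 <= D -> 0 <= E -> 0 <= mi -> 0 < lam ->
  (n - 2 * k) ^+ 2 <= 4 * lam ^+ 2 -> lam ^+ 2 <= D * E - mi + 4 * k * D ->
  [/\ 435 / 1000 * n <= D, 432 / 1000 * n <= E, mi * 10000 <= 425 / 10 * n ^+ 2 / 1
    & 1000 * lam <= 503 * n].
Proof.
move=> DE k0 kn D0 E0 mi0 l0 h1 h2.
have n0 : 0 <= n by clear -kn k0; lra.
(* The value 12/712 + 12/712^2 is just below (13/100)^2. *)
have kk : 12 * k * n + 12 * k ^+ 2 <= 169 / 10000 * n ^+ 2.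
  have a1 : k * n <= n / 712 * n by rewrite ler_wpM2r //; clear -kn; lra.
  have a2 : k * k <= n / 712 * (n / 712) by apply: ler_pM => //; clear -kn; lra.
  have nn : 0 <= n * n by rewrite mulr_ge0.
  by clear -a1 a2 nn; rewrite !expr2; lra.
have eE : E = n - D by clear -DE; lra.
(* Completing the square in D: the two bounds on lam^2 combine to at most 12 k n + 12 k^2 on the
   right. *)
have key : (n + 4 * k - 2 * D) ^+ 2 + 4 * mi <= 169 / 10000 * n ^+ 2.
  by rewrite eE in h2; apply: le_trans kk; move: h1 h2; clear; rewrite !expr2; lra.
have sq0 : (n + 4 * k - 2 * D) ^+ 2 <= (13 / 100 * n) ^+ 2.
  by rewrite exprMn; clear -key mi0; lra.
have ab : `|n + 4 * k - 2 * D| <= 13 / 100 * n.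
  rewrite -ler_sqr ?nnegrE ?normr_ge0 // ?real_normK ?num_real //.
  by clear -n0; lra.
move: ab; rewrite ler_norml => /andP[ab1 ab2].
have sq1 := sqr_ge0 (n + 4 * k - 2 * D).
split; [by clear -ab2 k0; lra | by clear -ab1 eE kn n0; lra | by have n2 := sqr_ge0 n; clear -key sq1 n2; lra |].
have l2 : 4 * lam ^+ 2 <= (n + 4 * k) ^+ 2.
  by rewrite eE in h2; move: h2 sq1 mi0; clear; rewrite !expr2; lra.
have : 2 * lam <= n + 4 * k.
  rewrite -ler_sqr ?nnegrE; [|by clear -l0; lra|by clear -n0 k0; lra].
  by rewrite exprMn; clear -l2; lra.
by clear -kn n0; lra.
Qed.

Lemma card_bad (R : realFieldType) (T : finType) (A : {set T}) (f : T -> nat) (n : nat) :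
  (17 * n * #|[set u in A | (17 * n < 100 * f u)%N]| <= 100 * \sum_(u in A) f u)%N.
Proof.
rewrite (mulnC (17 * n)) -sum_nat_const big_distrr /= [leqRHS](bigID (fun u => 17 * n < 100 * f u)%N) /=.
apply: leq_trans (leq_addr _ _).
rewrite (eq_bigl (fun u => (u \in A) && (17 * n < 100 * f u)%N)) => [|u]; last by rewrite inE.
by apply: leq_sum => u /andP[_ /ltnW].
Qed.

Lemma dense_core (R : realType) (n k : nat) (G : rel 'I_n) (lam : R) (x : 'I_n -> R) :
  simple_graph G -> ~ has_cycle (2 * k + 1) G -> (2 <= k)%N -> (712 * k <= n)%N ->
  0 < lam -> (n%:R - 2 * k%:R) ^+ 2 <= 4 * lam ^+ 2 ->
  (forall v, 0 <= x v) -> (exists v, 0 < x v) ->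
  (forall v, lam * x v <= \sum_(u | G v u) x u) ->
  exists H : bool -> {set 'I_n},
    [/\ forall d, {in H d, forall v : 'I_n, rich G (4 * k) (H (~~ d)) v},
        (20 * #|~: (H false :|: H true)| <= n)%N,
        forall d, (4 * n <= 10 * #|H d|)%N & 1000 * lam <= 503 * n%:R].
Proof.
move=> [symG irrG] noC k2 nk l0 lam_n x0 [v1 xv1] subx.
have [v vmax] := max_entry x v1.
have xv : 0 < x v by apply: lt_le_trans (vmax v1).
pose N := nbr G setT v; pose M := ~: N.
pose side (d : bool) := if d then M else N.
pose miss d u := #|[set w in side (~~ d) | ~~ G u w]|.
(* At most 425/100000 n^2 edges are missing, so at most n/40 vertices per side miss more than 17/100
   n. The opposite [H] keeps at least 407/1000 n vertices, more than twice 17/100 n plus 4k, which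
   gives richness. *)
pose H d := [set u in side d | (100 * miss d u <= 17 * n)%N].
have walks := walks2_ge (ltW l0) vmax xv subx.
(* A path on [2 * k] neighbours of [v] closes through [v] to a forbidden cycle. *)
have noP (w : 'I_n) p : size p = (2 * k - 1)%N -> path G w p -> uniq (w :: p) -> ~ {subset w :: p <= N}.
  move=> szp pp up sub; apply: noC; apply: (@has_cycle_seq _ _ G (v :: w :: p)).
  - rewrite /= rcons_path pp /=.
    have : w \in N by apply: sub; rewrite mem_head.
    rewrite !inE /= => ->; rewrite symG.
    have lN : last w p \in N by apply: sub; apply: mem_last.
    by move: lN; rewrite !inE.
  - rewrite cons_uniq up andbT; apply/negP => /sub.
    by rewrite !inE irrG.
  - by rewrite /= szp; nlia.
have degN := degree_sum_le symG irrG noP.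
have missE : (\sum_(u in N) miss false u = \sum_(u in M) miss true u)%N.
  rewrite /miss /=; under eq_bigr => u _ do rewrite -sum1_card.
  under [RHS]eq_bigr => u _ do rewrite -sum1_card.
  rewrite (exchange_big_dep (mem M)) /=; last by move=> u w _; rewrite !inE => /andP[].
  apply: eq_bigr => w wM; apply: eq_bigl => u; rewrite !inE (symG u w).
  by move: wM; rewrite !inE => ->.
have degM u : (#|nbr G M u| + miss false u = #|M|)%N.
  rewrite -(cardsID [set w | G u w] M) /miss; congr (_ + _)%N; apply: eq_card => w; rewrite !inE //.
  by rewrite andbC.
have sumM : (\sum_(u in N) #|nbr G M u| + \sum_(u in N) miss false u = #|N| * #|M|)%N.
  by rewrite -big_split /= (eq_bigr (fun=> #|M|)) ?sum_nat_const.
have degT u : (#|nbr G setT u| = #|nbr G M u| + #|nbr G N u|)%N.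
  rewrite -(cardsID M (nbr G setT u)); congr (_ + _)%N; apply: eq_card => w; rewrite !inE.
    by rewrite andbC.
  by rewrite negbK.
have walksN : (\sum_(u in N) #|nbr G setT u| + \sum_(u in N) miss false u <=
    #|N| * #|M| + 4 * k * #|N|)%N.
  rewrite (eq_bigr _ (fun u _ => degT u)) big_split /= -sumM.
  rewrite addnAC -!addnA leq_add2l leq_add2l; apply: leq_trans degN _.
  by rewrite leq_mul2r; apply/orP; right; nlia.
have NM : (#|N| + #|M| = n)%N by rewrite cardsC card_ord.
have [|||||||bN bM bmi lhi] := @core_arith R n%:R k%:R (#|N|)%:R (#|M|)%:R (\sum_(u in N) miss false u)%:R lam _ _ _ _ _ _ l0 lam_n; rewrite ?ler0n //.
- by rewrite -natrD NM.
- by rewrite -(natrM R 712) ler_nat.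
- have := walksN; rewrite -(ler_nat R) !natrD !natrM => h.
  by apply: le_trans walks _; move: h; clear; lra.
have n0 : 0 < n%:R :> R by rewrite ltr0n; nlia.
have bad d : (40 * #|side d :\: H d| <= n)%N.
  have : (17 * n * #|side d :\: H d| <= 100 * \sum_(u in N) miss false u)%N.
    have -> : (\sum_(u in N) miss false u = \sum_(u in side d) miss d u)%N by case: d.
    apply: leq_trans (card_bad R (side d) (miss d) n); rewrite leq_mul2l; apply/orP; right.
    by apply/subset_leq_card/fintype.subsetP => u; rewrite !inE negb_and -ltnNge; case: (u \in side d); rewrite ?andbF ?andbT.
  rewrite -(ler_nat R) !natrM => h; rewrite -(ler_nat R) natrM.
  have h2 : 17 * n%:R * (#|side d :\: H d|)%:R <= n%:R * (425 / 1000 * n%:R) :> R.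
    by apply: le_trans h _; move: bmi; clear; rewrite expr2; lra.
  have h3 : 17 * (#|side d :\: H d|)%:R <= 425 / 1000 * n%:R :> R.
    by rewrite -(ler_pM2l n0) mulrCA mulrA.
  by move: h3; clear; lra.
have cH d : (#|side d| <= #|H d| + #|side d :\: H d|)%N.
  rewrite -(cardsID (H d) (side d)) leq_add2r; apply/subset_leq_card/fintype.subsetP => u.
  by rewrite inE => /andP[].
have sd d : 432 / 1000 * n%:R <= (#|side d|)%:R :> R.
  by case: d => //; move: bN n0; clear; lra.
have H407 d : 407 / 1000 * n%:R <= (#|H d|)%:R :> R.
  have := sd d; have := cH d; have := bad d.
  rewrite -!(ler_nat R) natrM natrD; clear; lra.
exists H; split=> [d u uH|||//].
- rewrite /rich -(ltr_nat R); have : (100 * miss d u <= 17 * n)%N by move: uH; rewrite inE => /andP[].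
  have : (#|H (~~ d)| <= #|nbr G (H (~~ d)) u| + miss d u)%N.
    rewrite -(cardsID [set w | G u w] (H (~~ d))); apply: leq_add.
      by apply/subset_leq_card/fintype.subsetP => w; rewrite !inE.
    by apply/subset_leq_card/fintype.subsetP => w; rewrite !inE => /andP[-> /andP[->]].
  have := H407 (~~ d); have : 712 * k%:R <= n%:R :> R by rewrite -(natrM R 712) ler_nat.
  rewrite -!(ler_nat R) !(natrM, natrD).
  by move: n0; clear; lra.
- have : (#|~: (H false :|: H true)| <= #|side false :\: H false| + #|side true :\: H true|)%N.
    apply: leq_trans (leq_card_setU _ _).
    apply/subset_leq_card/fintype.subsetP => u; rewrite in_setC in_setU negb_or => /andP[h0 h1].
    by rewrite in_setU !in_setD h0 h1 /= /M in_setC orbN.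
  move=> hh; have b0 := bad false; have b1 := bad true; clear -hh b0 b1.
  move: hh b0 b1; set a := #|_|; set b := #|_|; set c := #|_|; lia.
- move=> d; rewrite -(ler_nat R) !natrM; have := H407 d; move: n0; clear; lra.
Qed.

Local Close Scope ring_scope.

(** * The target graph *)

Lemma class_bijection (n : nat) (C : eqType) (f g : 'I_n -> C) :
  (forall x, #|[set v | f v == x]| = #|[set v | g v == x]|) ->
  exists p : 'I_n -> 'I_n, bijective p /\ forall v, f v = g (p v).
Proof.
move=> fg; pose s := [tuple f i | i < n]; pose t := [tuple g i | i < n].
have cnt (h : 'I_n -> C) x : count_mem x [tuple h i | i < n] = #|[set v | h v == x]|.
  rewrite /= count_map cardsE cardE enumT /enum_mem size_filter; apply: eq_count => v.
  by [].
have : perm_eq s t by apply/allP => x _; rewrite /= !cnt fg.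
case/tuple_permP=> p eqs; exists (fun v => p v); split; first by apply: injF_bij; apply: perm_inj.
move=> v; have : tnth s v = tnth [tuple tnth t (p i) | i < n] v.
  by congr tnth; apply: val_inj.
by rewrite !tnth_mktuple.
Qed.

Section PendantIso.
Variables (T : finType) (B : {set T}) (c : T -> bool) (att : T -> T) (b0 : T).
Hypotheses (b0B : b0 \in B) (attid : {in B, att =1 id}) (att0 : forall w, w \notin B -> att w = b0).

(* 0: the root b0; 1: suspended vertices; 2, 3: the classes of B with the colour
   of b0 (without b0) and with the other colour. *)
Definition role (v : T) : nat :=
  if v \in B then if v == b0 then 0 else if c v == c b0 then 2 else 3 else 1.

Definition role_adj (i j : nat) : bool :=
  match i, j with
  | 0, 1 | 1, 0 | 1, 1 | 0, 3 | 3, 0 | 2, 3 | 3, 2 => true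
  | _, _ => false
  end.

Lemma full_role u v : full B c att u v = (u != v) && role_adj (role u) (role v).
Proof.
rewrite /full /role.
case: (boolP (u \in B)) => uB; case: (boolP (v \in B)) => vB /=; rewrite ?(attid uB) ?(attid vB) ?(att0 uB) ?(att0 vB).
- rewrite andbN orbF; case: (eqVneq u b0) => [->|ub]; case: (eqVneq v b0) => [->|vb];
    rewrite ?eqxx //=.
  + by case: (c v) (c b0) => [] [].
  + by rewrite ub; case: (c u) (c b0) => [] [].
  case: (eqVneq u v) => [->|_]; first by rewrite eqxx.
  by case: (c u) (c v) (c b0) => [] [] [].
- case: (eqVneq u b0) => [->|ub] /=; first by rewrite andbT.
  by case: (c u == c b0); rewrite andbF.
- rewrite (eq_sym b0); case: (eqVneq v b0) => [->|vb] /=; first by rewrite andbT.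
  by case: (c v == c b0); rewrite andbF.
- by rewrite eqxx andbT.
Qed.

Lemma card_role x : #|[set v | role v == x]| =
  match x with
  | 0 => 1
  | 1 => #|~: B|
  | 2 => #|cls B c (c b0)|.-1
  | 3 => #|B| - #|cls B c (c b0)|
  | _ => 0
  end.
Proof.
case: x => [|[|[|[|x]]]].
- rewrite -(cards1 b0); apply: eq_card => v; rewrite !inE /role.
  case: (eqVneq v b0) => [->|vb]; first by rewrite b0B.
  by case: ifP => //; case: ifP.
- apply: eq_card => v; rewrite !inE /role; case: ifP => //= vB.
  by case: ifP => //; case: ifP.
- rewrite (cardsD1 b0 (cls B c (c b0))) inE b0B eqxx /=; apply: eq_card => v; rewrite !inE /role.
  by case: (v \in B) => //=; case: (v == b0) => //=; case: ifP.
- have -> : #|B| - #|cls B c (c b0)| = #|B :\: cls B c (c b0)|.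
    have -> : cls B c (c b0) = B :&: cls B c (c b0).
      by apply/setP => v; rewrite !inE andbA andbb.
    by rewrite setDIr setDv set0U -(cardsID (cls B c (c b0)) B) addKn.
  apply: eq_card => v; rewrite !inE /role; case: (v \in B) => //=. 
  by case: (eqVneq v b0) => [->|_]; rewrite ?eqxx //; case: (c v == c b0).
- apply/eqP; rewrite cards_eq0; apply/eqP/setP => v; rewrite !inE /role.
  by case: ifP => //; case: ifP => //; case: ifP.
Qed.
End PendantIso.

Lemma card_ord_lt (n s : nat) : s <= n -> #|[set v : 'I_n | v < s]| = s.
Proof.
move=> sn; rewrite -sum1_card (eq_bigl (fun v : 'I_n => v < s)) => [|v]; last by rewrite inE.
by rewrite -(big_ord_widen n (fun=> 1) sn) sum1_card card_ord.
Qed.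

Section TargetGraph.
Variables (n r : nat).
Hypotheses (n0 : 0 < n) (r0 : 1 < r) (rn : r + 2 < n).

Definition TKbase : {set 'I_n} := [set v | in_T r v].
Definition TKatt (v : 'I_n) : 'I_n := if in_T r v then v else Ordinal n0.

Lemma TKatt_base v : TKatt v \in TKbase.
Proof. by rewrite inE /TKatt; case: ifP => // _; rewrite /in_T eqxx. Qed.

Lemma TKatt_id : {in TKbase, TKatt =1 id}.
Proof. by move=> v; rewrite inE /TKatt => ->. Qed.

Lemma TKatt_out w : w \notin TKbase -> TKatt w = Ordinal n0.
Proof. by rewrite inE /TKatt => /negPf->. Qed.

Lemma TK_full : TK n r =2 full TKbase (@in_small n r) TKatt.
Proof.
move=> u v; rewrite /TK /full !inE; congr (_ || _); rewrite /TKatt.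
have inT (w : 'I_n) : in_T r w = (w == 0 :> nat) || (r <= w) by [].
have val0 (w : 'I_n) : (Ordinal n0 == w) = (w == 0 :> nat) by rewrite -val_eqE /= eq_sym.
have val0' (w : 'I_n) : (w == Ordinal n0) = (w == 0 :> nat) by rewrite -val_eqE.
case: (boolP (in_T r u)) => Tu; case: (boolP (in_T r v)) => Tv.
- rewrite andbN; apply/negbTE; apply: contraL isT => /and3P[ur vr uv]; exfalso.
  case/negP: uv; rewrite -val_eqE /=; move: Tu Tv; rewrite !inT; lia.
- rewrite val0' andbA; congr (_ && _).
  by move: Tu Tv; rewrite !inT; lia.
- rewrite val0 andbA; congr (_ && _).
  by move: Tu Tv; rewrite !inT; lia.
- rewrite eqxx /= andbA; have -> : (u < r) && (v < r) by move: Tu Tv; rewrite !inT; lia.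
  by [].
Qed.

Lemma card_TKout : #|~: TKbase| = r - 1.
Proof.
have c1 := card_ord_lt (s := 1) n0; have cr := card_ord_lt (n := n) (s := r) _.
rewrite (_ : ~: TKbase = [set v : 'I_n | v < r] :\: [set v : 'I_n | v < 1]).
  rewrite cardsD cr; last by nlia.
  rewrite (_ : _ :&: _ = [set v : 'I_n | v < 1]) ?c1 //.
  by apply/setP => v; rewrite !inE; lia.
by apply/setP => v; rewrite !inE /in_T; lia.
Qed.

Lemma card_TKbase : #|TKbase| = n - r + 1.
Proof.
have := cardsC TKbase; rewrite card_TKout card_ord.
by nlia.
Qed.

Lemma card_TKsmall : #|cls TKbase (@in_small n r) true| = (n - r + 1)./2.
Proof.
set a := (n - r + 1)./2.
have a2 : a + a <= n - r + 1 by have := odd_double_half (n - r + 1); rewrite -/a; nlia.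
have a1 : 0 < a by rewrite /a half_gt0; nlia.
have c1 := card_ord_lt (s := 1) n0.
have cr := card_ord_lt (n := n) (s := r) _; have ca := card_ord_lt (n := n) (s := r + a - 1) _.
have -> : cls TKbase (@in_small n r) true =
    [set v : 'I_n | v < 1] :|: ([set v : 'I_n | v < r + a - 1] :\: [set v : 'I_n | v < r]).
  by apply/setP => v; rewrite !inE /in_T /in_small -/a eqb_id; lia.
rewrite cardsU c1 cardsD ca; last by nlia.
rewrite (_ : [set v : 'I_n | v < r + a - 1] :&: _ = [set v : 'I_n | v < r]); last first.
  by apply/setP => v; rewrite !inE; lia.
rewrite cr; last by nlia.
rewrite (_ : _ :&: _ = set0) ?cards0; first by nlia.
by apply/setP => v; rewrite !inE; lia.
Qed.

Lemma TKroot_base : Ordinal n0 \in TKbase /\ in_small r (Ordinal n0).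
Proof. by rewrite inE /in_T /in_small eqxx. Qed.

(** The count at [b0] exhausts the complement of [B], so everything is suspended at [b0] and
    adjacency depends on roles alone. Any bijection matching the roles is then an isomorphism, and
    the roles have equal sizes. *)
Lemma pendant_iso_TK (G : rel 'I_n) (B : {set 'I_n}) (c : 'I_n -> bool) att b0 :
  G =2 full B c att -> {in B, att =1 id} -> b0 \in B -> #|~: B| = r - 1 ->
  pend B att b0 = r - 1 -> #|cls B c (c b0)| = (n - r + 1)./2 -> graph_iso G (TK n r).
Proof.
move=> Gfull attid b0B cB pb cc.
have att0 w : w \notin B -> att w = b0.
  have eqW : [set w | (w \notin B) && (att w == b0)] = ~: B.
    apply/eqP; rewrite eqEcard -/(pend B att b0) pb cB leqnn andbT.
    by apply/fintype.subsetP => v; rewrite !inE => /andP[].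
  by move=> wB; have : w \in ~: B; [rewrite inE | rewrite -eqW inE => /andP[_ /eqP]].
have [vB vs] := TKroot_base.
have [|p [bij roles]] := @class_bijection n nat (role B c b0) (role TKbase (@in_small n r) (Ordinal n0)).
  move=> x; rewrite !card_role // vs cB card_TKout card_TKsmall cc card_TKbase.
  have -> : #|B| = n - r + 1 by have := cardsC B; rewrite cB card_ord; nlia.
  by [].
exists p; split=> // u v; rewrite Gfull TK_full (full_role c attid att0).
rewrite (full_role (@in_small n r) TKatt_id TKatt_out) !roles; congr (_ && _).
by rewrite (inj_eq (bij_inj bij)).
Qed.
End TargetGraph.

Lemma pendant_family (n r : nat) (G : rel 'I_n) (B : {set 'I_n}) (c : 'I_n -> bool) att b0 :
  simple_graph G -> (forall u v, G u v -> full B c att u v) ->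
  (forall v, att v \in B) -> {in B, att =1 id} -> b0 \in B -> #|~: B| <= r - 2 ->
  in_family r G.
Proof.
move=> [symG irrG] Gfull attB attid b0B cB.
(* Every vertex indexes a suspended graph; an index outside [B] gets the single vertex [b0], which
   meets [B] once and adds nothing to the total. *)
pose VG (i : 'I_n) := if i \in B then i |: [set w | (w \notin B) && (att w == i)] else [set b0].
exists B, (fun u v => [&& u \in B, v \in B & G u v]), n, VG, (fun i u v => [&& u \in VG i, v \in VG i & G u v]).
split; last split; last split; last split.
- split.
  + by move=> u v /and3P[-> ->].
  + by move=> u v; rewrite symG andbCA.
  + by move=> u; rewrite irrG !andbF.
  + exists c => u v /and3P[uB vB /Gfull]; case/orP=> [/and3P[]//|/andP[/eqP]].
    by rewrite !attid // => ->; rewrite eqxx.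
- split.
  + by move=> i u v /and3P[-> ->].
  + move=> i; split=> [u v|u]; first by rewrite symG andbCA.
    by rewrite irrG !andbF.
  + move=> i; rewrite /VG; case: (boolP (i \in B)) => iB.
      rewrite -(cards1 i); apply: eq_card => w; rewrite !inE.
      by case: eqP => [->|_] //=; case: (w \in B); rewrite ?andbF.
    rewrite -(cards1 b0); apply: eq_card => w; rewrite !inE.
    by case: eqP => [->|//]; rewrite b0B.
- apply/setP => v; rewrite !inE; case: (boolP (v \in B)) => //= vB.
  by apply/bigcupP; exists (att v) => //; rewrite /VG attB !inE vB eqxx orbT.
- move=> u v; apply/idP/orP => [uv|[/and3P[]//|/existsP[i /and3P[]//]]].
  case: (boolP ((u \in B) && (v \in B))) => [/andP[uB vB]|nB]; first by left; rewrite uB vB.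
  right; apply/existsP; exists (att u).
  have auv : att u = att v.
    by case/orP: (Gfull _ _ uv) => [/and3P[uB vB _]|/andP[/eqP]] //; rewrite uB vB in nB.
  have inV w : w \in VG (att w).
    rewrite /VG attB !inE eqxx andbT; case: (boolP (w \in B)) => wB; last by rewrite orbT.
    by rewrite attid // eqxx.
  by rewrite inV auv inV.
- apply: leq_trans cB; rewrite -(sum_pend attB) [leqRHS]big_mkcond; apply: leq_sum => i _.
  rewrite /VG; case: (boolP (i \in B)) => iB.
    rewrite /pend; apply/subset_leq_card/fintype.subsetP => w; rewrite !inE.
    by case: eqP => [->|_] /=; [rewrite iB | case/andP].
  rewrite leqn0 cards_eq0; apply/eqP/setP => w; rewrite !inE.
  by case: eqP => [->|_]; rewrite ?b0B ?andbF.
Qed.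

(** * An eigenvalue of the target graph *)

Local Open Scope ring_scope.

Lemma target_root (R : rcfType) (a b s n : nat) :
  (0 < s)%N -> (0 < b)%N -> (a <= n)%N -> (b <= n)%N -> (s <= n)%N ->
  exists lam : R, s%:R < lam /\ lam ^+ 2 = a%:R * b%:R + b%:R * gain lam s.
Proof.
move=> s0' b0' an' bn' sn'.
have s0 : 0 < s%:R :> R by rewrite ltr0n.
have b0 : 0 < b%:R :> R by rewrite ltr0n.
have a0 : 0 <= a%:R :> R by apply: ler0n.
have an : a%:R <= n%:R :> R by rewrite ler_nat.
have bn : b%:R <= n%:R :> R by rewrite ler_nat.
have sn : s%:R <= n%:R :> R by rewrite ler_nat.
have n1 : 1 <= n%:R :> R by rewrite (ler_nat R 1); apply: leq_trans bn'.
rewrite /gain; move: (s%:R : R) (n%:R : R) (a%:R : R) (b%:R : R) s0 b0 a0 an bn sn n1.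
clear => s n a b s0 b0 a0 an bn sn n1.
(* The equation for [lam] with its denominators cleared; [p] is negative at s and nonnegative at
   2n. *)
pose p : {poly R} := ('X^2 - (a * b)%:P) * ('X + 1) * ('X - s%:P) - (b * s)%:P.
have pE x : p.[x] = (x ^+ 2 - a * b) * (x + 1) * (x - s) - b * s by rewrite /p !hornerE.
have [||x /andP[sx xn] /rootP px] := @poly_ivt R p s (2 * n).
- by clear -sn n1; lra.
- rewrite !pE; apply/andP; split; first by rewrite subrr mulr0 sub0r oppr_le0 mulr_ge0 // ltW.
  rewrite subr_ge0.
  have h1 : a * b <= n * n by apply: ler_pM => //; apply: ltW.
  have h2 : b * s <= n * n by apply: ler_pM => //; apply: ltW.
  have h3 : 0 <= n * n - b * s by rewrite subr_ge0.
  have q1 : n * n <= (2 * n) ^+ 2 - a * b by clear -h1 n1; nra.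
  have q2 : 1 <= (2 * n + 1) * (2 * n - s) by clear -sn n1; nra.
  apply: le_trans h2 _; rewrite -mulrA -[leLHS]mulr1; apply: ler_pM => //.
  by rewrite mulr_ge0 //; clear -n1; lra.
have xs : s < x.
  rewrite lt_neqAle sx andbT; apply/eqP => e; move: px.
  rewrite pE -e subrr mulr0 sub0r => /eqP; rewrite oppr_eq0 mulf_eq0 !gt_eqF //.
exists x; split=> //.
have d1 : x + 1 != 0 by rewrite gt_eqF //; clear -xs s0; lra.
have d2 : x - s != 0 by rewrite gt_eqF // subr_gt0.
move: px; rewrite pE -mulrA => /eqP; rewrite subr_eq0 => /eqP px.
have -> : x ^+ 2 = a * b + (x ^+ 2 - a * b) by rewrite addrC subrK.
congr (_ + _); rewrite mulrA -px; field.
by rewrite d1 d2.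
Qed.

(** Turns the equation satisfied by lam0 into an inequality that involves only the possibly larger
    eigenvalue of G. *)
Lemma gain_antitone (R : realFieldType) (lam mu : R) (s : nat) :
  s%:R < lam -> lam <= mu -> gain mu s <= gain lam s.
Proof.
move=> sl lm; have s0 : 0 <= s%:R :> R by apply: ler0n.
rewrite /gain ler_wpM2l // lef_pV2 ?posrE; last 2 first.
- by apply: mulr_gt0; clear -sl lm s0; lra.
- by apply: mulr_gt0; clear -sl lm s0; lra.
by apply: ler_pM; clear -sl lm s0; lra.
Qed.

Lemma TK_eigenvalue (R : realType) (n r : nat) (lam : R) : (1 < r)%N -> (r + 2 < n)%N ->
  (r - 1)%:R < lam ->
  let a := (n - r + 1)./2 in let b := (n - r + 1 - a)%N in
  lam ^+ 2 = a%:R * b%:R + b%:R * gain lam (r - 1) -> eigenvalue (adjmx R (TK n r)) lam.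
Proof.
move=> r1 rn rlam a b eqlam.
have n0 : (0 < n)%N by nlia.
set B := TKbase n r; set c := @in_small n r; set att := TKatt r n0; set v0 := Ordinal n0.
have attB v : att v \in B by apply: TKatt_base.
have attid : {in B, att =1 id} by move=> v; apply: TKatt_id.
have [v0B sv0] := TKroot_base r n0.
have pend0 : pend B att v0 = (r - 1)%N.
  rewrite -(card_TKout n0 r1 rn); apply: eq_card => w; rewrite inE [RHS]inE.
  case: (boolP (w \in B)) => //= wB; rewrite /att /TKatt.
  by move: wB; rewrite inE => /negPf->; rewrite eqxx.
have pendn v : v != v0 -> v \in B -> pend B att v = 0%N.
  move=> vv0 vB; apply/eqP; rewrite cards_eq0; apply/eqP/setP => w; rewrite !inE.
  case: (boolP (in_T r w)) => //= wB; rewrite /att /TKatt (negPf wB).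
  by rewrite eq_sym (negPf vv0).
have lam0 : 0 < lam by apply: le_lt_trans rlam; apply: ler0n.
have pl v : (pend B att v)%:R < lam.
  apply: le_lt_trans rlam; rewrite ler_nat -(card_TKout n0 r1 rn).
  by apply/subset_leq_card/fintype.subsetP => w; rewrite !inE => /andP[].
have effT : eff B c att lam true = a%:R + gain lam (r - 1).
  rewrite effE (card_TKsmall n0 r1 rn); congr (_ + _).
  rewrite (bigD1 v0) /= ?inE ?v0B ?sv0 // pend0 big1 ?addr0 // => v.
  rewrite inE => /andP[/andP[vB _] vv0].
  by rewrite pendn // /gain mul0r.
have effF : eff B c att lam false = b%:R.
  rewrite effE big1 ?addr0 => [|v]; last first.
    rewrite inE => /andP[vB /eqP cv]; rewrite pendn // /gain ?mul0r //.
    by apply: contraTneq sv0 => e; rewrite -/v0 -e -/(c v) cv.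
  congr (_%:R); have := card_cls B c; rewrite (card_TKsmall n0 r1 rn) (card_TKbase n0 r1 rn).
  by rewrite /b -/a; nlia.
(* The two [eff] multiply to exactly [lam ^+ 2] here, so these weights solve the equation at both
   colours. *)
pose wt (d : bool) : R := if d then 1 else eff B c att lam true / lam.
have wtE d : wt (~~ d) * eff B c att lam (~~ d) = lam * wt d.
  case: d; rewrite /wt /= ?mulr1 ?mul1r; last by rewrite mulrCA divff ?mulr1 // gt_eqF.
  apply: (mulfI (lt0r_neq0 lam0)); rewrite mulrA mulrCA divff ?gt_eqF // mulr1 effF effT.
  by rewrite -expr2 eqlam; ring.
have wt0 d : 0 < wt d.
  case: d; rewrite /wt //= divr_gt0 // effT ltr_wpDr //; last first.
    by rewrite ltr0n /a half_gt0; nlia.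
  by rewrite -pend0 gain_ge0 // => v; apply: pl.
apply: (@eigenvalue_of_vec R n (TK n r) _ lam (pweight B c att lam wt) v0).
- by move=> u v; rewrite !(TK_full n0 r1 rn); apply: full_sym.
- by rewrite gt_eqF // pweight_gt0.
move=> v; rewrite (eq_bigl (full B c att v)) => [|u]; last by rewrite (TK_full n0 r1 rn).
case: (boolP (v \in B)) => vB; last by rewrite full_sum_pendant.
by rewrite full_sum_base // wtE /pweight vB; ring.
Qed.

Local Close Scope ring_scope.

(** * Excluding wrong ears: shortest ear *)

Lemma in_nbr (T : finType) (G : rel T) (A : {set T}) v u : (u \in nbr G A v) = (u \in A) && G v u.
Proof. by rewrite inE. Qed.

Lemma in_cls (T : finType) (B : {set T}) (c : T -> bool) d v :
  (v \in cls B c d) = (v \in B) && (c v == d).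
Proof. by rewrite inE. Qed.

Lemma leq_quad (a c x f y : nat) : a <= c -> x + f <= 4 * y -> 4 * a + x + f <= 4 * (c + y).
Proof. lia. Qed.

(** Lets [ear_ends_nonadj] apply to every core neighbour of an end vertex of the ear. *)
Lemma ear_swap_end (T : finType) (G : rel T) (S : {set T}) s q t v :
  ear G S s q t -> v \in S -> v != s -> G (last s q) v -> ear G S s q v.
Proof.
case/and5P=> sS tS pq uq aq vS vs lv; rewrite /ear sS vS aq andbT !andTb.
move: pq uq; rewrite !rcons_path lv andbT => /andP[-> _].
rewrite -!rcons_cons !rcons_uniq !inE => /andP[_ ->]; rewrite andbT negb_or vs /=.
by apply/negP => /(allP aq); rewrite vS.
Qed.

(** Since r <= 2k, p + q + o <= m. If o > 0, each of the o vertices loses 1/4 and regains 2/50, so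
    the factors sum to at most m - 21/100. If o = 0, integrality gives p q <= a b, and the strict
    bound on lam^2 decides. *)
Lemma base_product_lt (R : realFieldType) (n k r o p q : nat) (lam : R) :
  2 <= k -> 3 <= r <= 2 * k -> 712 * k <= n -> p + q + o + (2 * k - 1) = n ->
  (((n - r + 1)./2 * (n - r + 1 - (n - r + 1)./2))%:R < lam ^+ 2)%R ->
  forall s t : nat, s + t = o ->
  ((p%:R + 3 / 4 * s%:R + o%:R / 50) * (q%:R + 3 / 4 * t%:R + o%:R / 50) < lam ^+ 2)%R.
Proof.
move=> k2 r2k nk pqo lt s t sto.
set m := n - r + 1 in lt; set a := m./2 in lt; set b := m - a in lt.
have mab : m = a + b by have := odd_double_half m; rewrite /b -/a; nlia.
have ab : a <= b <= a.+1 by have := odd_double_half m; rewrite /b -/a; case: (odd m) => /= h; nlia.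
have pqm : p + q + o <= m by rewrite /m; nlia.
apply: le_lt_trans lt.
have [o0|o0] := posnP o.
  have [s0 t0] : s = 0 /\ t = 0 by nlia.
  rewrite o0 s0 t0 mul0r !mulr0 !addr0 -natrM ler_nat.
  apply: (@leq_trans (p * (m - p))); first by rewrite leq_mul2l; apply/orP; right; nlia.
  have pm : p + (m - p) = a + b by nlia.
  by case: (prod_le_balanced pm ab) => [[-> ->]|[-> ->]|/ltnW] //; rewrite mulnC.
have h1 : (p%:R + q%:R + o%:R <= m%:R :> R)%R by rewrite -!natrD ler_nat.
have h2 : (s%:R + t%:R = o%:R :> R)%R by rewrite -natrD sto.
have o1 : (1 <= o%:R :> R)%R by rewrite (ler_nat R 1).
have mm : (m%:R * m%:R <= 4 * (a * b)%:R + 1 :> R)%R.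
  have : m * m <= 4 * (a * b) + 1 by move: ab mab; clear; move: m a b => u v z; nia.
  by rewrite -(ler_nat R) (natrD _ (4 * (a * b))) (natrM R m) (natrM R 4).
have m3 : (3 <= m%:R :> R)%R by rewrite (ler_nat R 3) /m; nlia.
set x := (p%:R + _ + _)%R; set y := (q%:R + _ + _)%R.
have p0 : (0 <= p%:R :> R)%R by apply: ler0n.
have q0 : (0 <= q%:R :> R)%R by apply: ler0n.
have s0 : (0 <= s%:R :> R)%R by apply: ler0n.
have t0 : (0 <= t%:R :> R)%R by apply: ler0n.
have h : (4 * (x * y) <= (m%:R - 21 / 100) ^+ 2)%R.
  by apply: prod_le_square; rewrite /x /y; clear -h1 h2 o1 p0 q0 s0 t0; lra.
rewrite -(ler_pM2l (_ : (0 < 4 :> R)%R)) //; apply: le_trans h _.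
by clear -mm m3; rewrite expr2; lra.
Qed.

Section NoWrongEar.
Variables (R : realType) (n k r : nat) (G : rel 'I_n) (H : bool -> {set 'I_n}).
Variables (lam : R) (x : 'I_n -> R).
Hypotheses (k2 : 2 <= k) (r2k : 3 <= r <= 2 * k) (nk : 712 * k <= n).
Hypotheses (symG : symmetric G) (irrG : irreflexive G).
Hypothesis noC : ~ has_cycle (2 * k + 1) G.
Hypothesis richH : forall d, {in H d, forall v : 'I_n, rich G (4 * k) (H (~~ d)) v}.
Hypothesis Hbig : 20 * #|~: (H false :|: H true)| <= n.
Hypothesis H40 : forall d, 4 * n <= 10 * #|H d|.
Hypotheses (lam_lo : (498 * n%:R <= 1000 * lam)%R) (lam_hi : (1000 * lam <= 503 * n%:R)%R).
Hypothesis lam_ab : (((n - r + 1)./2 * (n - r + 1 - (n - r + 1)./2))%:R < lam ^+ 2)%R.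
Hypotheses (x0 : forall v, (0 <= x v)%R) (xpos : exists v, (0 < x v)%R)
  (subx : forall v, (lam * x v <= \sum_(u | G v u) x u)%R).

Let S := core k G H.
Let sd := side k G H.

(** Extends the sides beyond the core: an outside vertex gets the colour opposite to its core
    neighbours, which are all on one side by [core_one_sided]. *)
Let col (v : 'I_n) : bool :=
  if v \in S then sd v else [exists u in S, G v u && ~~ sd u].

Let colG u v : u \in S -> G v u -> col u != col v.
Proof.
move=> uS vu; rewrite /col uS; case: ifP => vS.
  by apply: core_bip => //; [rewrite symG | apply: contraTneq vu => ->; rewrite irrG].
case: (boolP (sd u)) => su.
  rewrite eq_sym eqb_id; apply/existsP => -[w /and3P[wS vw sw]].
  have e := core_one_sided symG k2 noC richH (negbT vS) uS wS vu vw.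
  by move: sw su; rewrite /sd e => /negPf->.
rewrite eq_sym eqbF_neg negbK; apply/existsP; exists u.
by rewrite uS vu su.
Qed.

(* base d counts the vertices that a core vertex of side d may see, where the end
   vertices p1 and pl of the ear count as 1 although they weigh only 3/4; the
   difference is the slack needed at s and t. *)
Lemma base_absurd s t p1 pl (M : {set 'I_n}) (base : bool -> nat) :
  p1 \notin S :|: M -> pl \notin S :|: M -> p1 != pl ->
  (forall v, v \in M -> v \notin S) -> #|M| <= 2 * k ->
  (forall u v, u \in S -> v \in M -> G v u -> (u == s) || (u == t)) ->
  base false + base true + #|~: (S :|: M) :\ p1 :\ pl| + (2 * k - 1) = n ->
  (forall d, #|cls S sd (~~ d)| <= base d) ->
  (forall v, v \in S -> 4 * #|nbr G S v| + 3 * (G v p1 + G v pl) + ((v == s) || (v == t))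
     <= 4 * base (sd v)) -> False.
Proof.
move=> p1O plO p1l MS M2k MG base_sum base_ge base_S.
set O := ~: (S :|: M); set O' := O :\ p1 :\ pl in base_sum; set o := #|O'| in base_sum.
have cO : #|O| = o.+2.
  have p1i : p1 \in O by rewrite in_setC.
  have pli : pl \in O by rewrite in_setC.
  by rewrite (cardsD1 p1 O) p1i (cardsD1 pl (O :\ p1)) in_setD1 eq_sym p1l pli.
pose oc d := #|cls O' col d|.
have oc_sum : oc false + oc true = o by rewrite /oc card_cls.
(* A core vertex of side d sees only outside vertices of colour [~~ d]; the term o/50 pays for the
   part of the weight of [M] that grows with o. *)
pose th (d : bool) : R := ((base d)%:R + 3 / 4 * (oc (~~ d))%:R + o%:R / 50)%R.
have colS v : v \in S -> col v = sd v by move=> vS; rewrite /col vS.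
have HS d v : v \in H d -> v \in S /\ col v = d.
  by move=> vH; have [vS <-] := H_core symG k2 noC richH vH; rewrite colS.
have oR : (0 <= o%:R :> R)%R by apply: ler0n.
have ocR : ((oc false)%:R + (oc true)%:R = o%:R :> R)%R by rewrite -natrD oc_sum.
have bR : ((base false)%:R + (base true)%:R + o%:R <= n%:R :> R)%R.
  by rewrite -!natrD ler_nat -base_sum leq_addr.
apply: (@ear_weights_absurd R n k o _ G S M H col s t lam x th) => //.
- exact: card_ord.
- by move=> u v uS _; apply: colG.
- move=> v d; rewrite !inE !negb_or => /andP[/andP[h0 h1] _].
  by rewrite leqNgt; case: d.
- move=> d; apply: (le_trans (y := (base d)%:R%R)).
    rewrite ler_nat; apply: leq_trans (base_ge d); apply/subset_leq_card/fintype.subsetP => v vH.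
    by have [vS cv] := HS _ _ vH; rewrite inE vS -(colS v vS) cv eqxx.
  by rewrite /th -addrA lerDl addr_ge0 ?divr_ge0 ?ler0n // mulr_ge0 ?ler0n //; lra.
- by rewrite /th /=; lra.
- by apply: base_product_lt k2 r2k nk base_sum lam_ab _ _ _; rewrite /= addnC.
move=> v vS; rewrite colS // /th.
have leO : #|nbr G O v| <= (G v p1 + G v pl) + oc (~~ sd v).
  rewrite (cardsD1 p1) (cardsD1 pl (_ :\ p1)) addnA; apply: leq_add.
    apply: leq_add; first by rewrite !inE; case: (G v p1); rewrite ?andbF ?leq_b1.
    by rewrite !inE; case: (G v pl); rewrite ?andbF ?leq_b1.
  apply/subset_leq_card/fintype.subsetP => u; rewrite !inE => /and3P[ul u1 /andP[uO vu]].
  rewrite ul u1 uO /=; have := colG vS; move/(_ u); rewrite symG => /(_ vu).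
  by rewrite colS //; case: (sd v) (col u) => [] [].
have := base_S v vS; rewrite -(ler_nat R) 2!natrD (natrM R 4) (natrM R 3) (natrM R 4) => hb.
move: leO; rewrite -(ler_nat R) natrD => leO.
move: hb leO oR; rewrite -/O; set e := ((_ + _)%N%:R)%R => hb leO oR'.
by move: hb; case: (_ || _); rewrite /=; lra.
Qed.

Lemma no_wrong_ear s q t : ~~ wrong_ear G S sd s q t.
Proof.
apply/negP => /shortest_wrong_ear {s q t} [s [q [t [wq minq]]]].
have szq := core_wrong_ear symG k2 noC richH wq.
case/andP: (wq) => eq /eqP par; case/and5P: (eq) => sS tS pq uq aq.
case: q => [|x1 q] in szq wq minq par eq pq uq aq *; first by move: szq; nlia.
case/lastP: q => [|m xl] in szq wq minq par eq pq uq aq *; first by move: szq; nlia.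
set q := x1 :: rcons m xl in szq wq minq par eq pq uq aq.
have qS v : v \in q -> v \notin S by move/(allP aq).
have uniqq : uniq q by move: uq; rewrite cons_uniq rcons_uniq => /and3P[].
have x1q : x1 \in q by rewrite mem_head.
have xlq : xl \in q by rewrite inE mem_rcons mem_head orbT.
have mq v : v \in m -> v \in q by move=> vm; rewrite inE mem_rcons inE vm !orbT.
have [x1m x1l xlm um] : [/\ x1 \notin m, x1 != xl, xl \notin m & uniq m].
  by move: uniqq; rewrite /= mem_rcons inE negb_or rcons_uniq => /andP[/andP[-> ->] /andP[-> ->]].
have Gs1 : G s x1 by case/andP: pq.
have Glt : G xl t by move: pq; rewrite rcons_path /= last_rcons => /andP[].
have szm : size q = (size m).+2 by rewrite /= size_rcons.
have c1 := colG sS; move/(_ x1): c1; rewrite symG => /(_ Gs1) c1.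
have cl := colG tS Glt.
have colS v : v \in S -> col v = sd v by move=> vS; rewrite /col vS.
rewrite (colS s sS) in c1; rewrite (colS t tS) in cl.
(* A long ear is truncated to keep [M] small; its further inner vertices count as ordinary vertices
   outside the core. *)
pose M := [set v in take (2 * k - 1) m].
have takem v : v \in take (2 * k - 1) m -> v \in m by apply: mem_take.
have cM : #|M| = size (take (2 * k - 1) m).
  by rewrite cardsE; apply/card_uniqP/take_uniq.
have MS v : v \in M -> v \notin S by rewrite inE => /takem/mq/qS.
have x1O : x1 \notin S :|: M.
  by rewrite in_setU negb_or qS //= inE; apply: contra x1m => /takem.
have xlO : xl \notin S :|: M.
  by rewrite in_setU negb_or qS //= inE; apply: contra xlm => /takem.
have M2k : #|M| <= 2 * k by rewrite cM size_take_min; nlia.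
have MG u v : u \in S -> v \in M -> G v u -> (u == s) || (u == t).
  move=> uS; rewrite inE => /takem vm vu; case/splitPr eqm : m / vm => [m1 m2].
  apply: (inner_nbrs symG wq minq (q1 := x1 :: m1) (v := v) (q2 := rcons m2 xl)) => //.
    by rewrite /q eqm /= rcons_cat.
  by case: (m2).
have cSM : #|S| + #|M| + #|~: (S :|: M)| = n.
  rewrite -[n in RHS]card_ord -(cardsC (S :|: M)) cardsU.
  rewrite (_ : S :&: M = set0) ?cards0 ?subn0 //; apply/setP => v; rewrite in_set0.
  by apply/negbTE; rewrite in_setI; apply/negP => /andP[vS /MS]; rewrite vS.
have cO : #|~: (S :|: M)| = #|~: (S :|: M) :\ x1 :\ xl|.+2.
  have x1i : x1 \in ~: (S :|: M) by rewrite in_setC.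
  have xli : xl \in ~: (S :|: M) by rewrite in_setC.
  by rewrite (cardsD1 x1 (~: _)) x1i (cardsD1 xl (_ :\ x1)) in_setD1 eq_sym x1l xli.
have clsS : #|cls S sd false| + #|cls S sd true| = #|S| by apply: card_cls.
have nbrS v : v \in S -> #|nbr G S v| <= #|cls S sd (~~ sd v)|.
  move=> vS; apply/subset_leq_card/fintype.subsetP => u; rewrite in_nbr => /andP[uS vu].
  rewrite in_cls uS /=; have := colG uS vu; rewrite (colS u uS) (colS v vS).
  by case: (sd v) (sd u) => [] [].
have colO v u : v \in S -> G v u -> u \notin S -> col u = ~~ sd v.
  by move=> vS vu uS; have := colG vS; move/(_ u); rewrite symG => /(_ vu); rewrite (colS v vS); case: (sd v) (col u) => [] [].
have x1S := qS _ x1q; have xlS := qS _ xlq.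
have vs1 v : v == s -> G v x1 by move/eqP->.
have vtl v : v == t -> G v xl by move/eqP->; rewrite symG.
(* The ear has size m + 2 inner vertices: at least 2k + 1, exactly 2k (then its
   ends cannot have a common neighbour), or exactly 2k - 1 (then a neighbour of one
   end is not adjacent to the other end of the ear). *)
have [big|small] := leqP (2 * k - 1) (size m).
  have cM' : #|M| = 2 * k - 1 by rewrite cM size_takel.
  apply: (@base_absurd s t x1 xl M
    (fun d => #|cls S sd (~~ d)| + (col x1 == ~~ d) + (col xl == ~~ d))) => //=.
  - move: clsS cSM cO cM' k2; set o := #|_ :\ xl|.
    by case: (col x1); case: (col xl); rewrite /=; nlia.
  - by move=> d; rewrite -addnA leq_addr.
  move=> v vS; have hS := nbrS v vS.
  have e1 : G v x1 -> col x1 == ~~ sd v by move=> h; rewrite (colO v x1 vS h x1S).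
  have el : G v xl -> col xl == ~~ sd v by move=> h; rewrite (colO v xl vS h xlS).
  have hb : 3 * (G v x1 + G v xl) + ((v == s) || (v == t)) <=
      4 * ((col x1 == ~~ sd v) + (col xl == ~~ sd v)).
    move: e1 el (vs1 v) (vtl v).
    case: (G v x1) (G v xl) (v == s) (v == t) (col x1 == _) (col xl == _)
      => [] [] [] [] [] [] //= h1 h2 h3 h4;
      first [by move: (h1 isT) | by move: (h2 isT) | by move: (h3 isT) | by move: (h4 isT)].
  by rewrite -[(#|cls S sd _| + _ + _)%N]addnA; apply: leq_quad.
have Mm : M = [set v in m] by apply/setP => v; rewrite !inE take_oversize //; nlia.
have cMm : #|M| = size m by rewrite cM take_oversize //; nlia.
have [e2k|n2k] := eqVneq (size m) (2 * k - 2).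
  have eqst : sd s = sd t.
    move: par; rewrite szm e2k; have -> : odd (2 * k - 2).+2 = false by rewrite oddS oddS negbK mul2n oddB ?odd_double //; nlia.
    by case: (sd s) (sd t) => [] [].
  have exl v : v \in S -> G v x1 -> G v xl -> False.
    move=> vS v1 vl; apply: (ear_inner_ends k2 noC eq _ vS).
    - by rewrite szm e2k; nlia.
    - exact: v1.
    - by rewrite /= last_rcons symG.
  have ecol : col x1 = col xl by rewrite (colO s x1 sS Gs1 x1S) eqst (colO t xl tS _ xlS) // symG.
  apply: (@base_absurd s t x1 xl M (fun d => #|cls S sd (~~ d)| + (col x1 == ~~ d))) => //=.
  - move: clsS cSM cO cMm e2k k2; set o := #|_ :\ xl|.
    by case: (col x1); rewrite /=; nlia.
  - by move=> d; rewrite leq_addr.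
  move=> v vS; have hS := nbrS v vS.
  have e1 : G v x1 -> col x1 == ~~ sd v by move=> h; rewrite (colO v x1 vS h x1S).
  have el : G v xl -> col x1 == ~~ sd v by move=> h; rewrite ecol (colO v xl vS h xlS).
  have hb : 3 * (G v x1 + G v xl) + ((v == s) || (v == t)) <= 4 * (col x1 == ~~ sd v).
    move: e1 el (vs1 v) (vtl v) (exl v vS).
    case: (G v x1) (G v xl) (v == s) (v == t) (col x1 == _) => [] [] [] [] [] //= h1 h2 h3 h4 h5;
      first [by case: (h5 isT isT) | by move: (h1 isT) | by move: (h2 isT) | by move: (h3 isT) | by move: (h4 isT)].
  by apply: leq_quad.
have szm3 : size m = 2 * k - 3 by move/eqP: n2k; move: szq szm small; nlia.
have odq : odd (size q).
  have e3 : (2 * k - 3).+2 = (2 * (k - 1)).+1 by nlia.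
  by rewrite szm szm3 e3 oddS mul2n odd_double.
rewrite odq in par.
have nst : sd t = ~~ sd s by move: par; case: (sd s) (sd t) => [] [].
have szq' : size q = 2 * k - 1 by rewrite szm szm3; nlia.
apply: (@base_absurd s t x1 xl M (fun d => #|cls S sd (~~ d)|)) => //=.
- move: clsS cSM cO cMm szm3 k2; set o := #|_ :\ xl|.
  by nlia.
move=> v vS; have hS := nbrS v vS.
have miss u : u \in S -> sd u = ~~ sd v -> ~~ G v u -> #|nbr G S v| < #|cls S sd (~~ sd v)|.
  move=> uS su vu; apply: proper_card; apply/properP; split; last first.
    by exists u; rewrite ?in_cls ?in_nbr ?uS ?su ?eqxx //= (negPf vu).
  apply/fintype.subsetP => w; rewrite in_nbr in_cls => /andP[wS vw].
  rewrite wS /=; have := colG wS vw; rewrite (colS w wS) (colS v vS).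
  by case: (sd v) (sd w) => [] [].
have hl : G v xl -> sd v = ~~ sd s /\ #|nbr G S v| < #|cls S sd (~~ sd v)|.
  move=> vl; have svs : sd v = ~~ sd s.
    move: (colO v xl vS vl xlS); rewrite (colO t xl tS _ xlS) ?(symG t) // nst.
    by case: (sd v) (sd s) => [] [].
  split=> //; apply: (miss s) => //; first by rewrite svs negbK.
  apply: (ear_ends_nonadj k2 noC (q := q)); last exact: szq'.
  apply: ear_swap_end eq vS _ _; last by rewrite /= last_rcons symG.
  by apply: contraTneq isT => e; move: svs; rewrite e; case: (sd s).
have h1 : G v x1 -> sd v = sd s /\ #|nbr G S v| < #|cls S sd (~~ sd v)|.
  move=> v1; have svs : sd v = sd s.
    move: (colO v x1 vS v1 x1S); rewrite (colO s x1 sS Gs1 x1S).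
    by case: (sd v) (sd s) => [] [].
  split=> //; apply: (miss t) => //; first by rewrite svs nst.
  apply: (ear_ends_nonadj k2 noC (q := rev q)); last by rewrite size_rev.
    apply: ear_swap_end (ear_rev symG eq) vS _ _.
      by apply: contraTneq isT => e; move: svs; rewrite e nst; case: (sd s).
    by rewrite /q rev_cons last_rcons symG.
case: (boolP (G v x1)) => v1; case: (boolP (G v xl)) => vl.
- by have [e1 _] := h1 v1; have [] := hl vl; rewrite e1; case: (sd s).
- have [_ lt] := h1 v1; have : ((v == s) || (v == t)) <= 1 by case: (_ || _).
  by move: lt; rewrite /=; nlia.
- have [_ lt] := hl vl; have : ((v == s) || (v == t)) <= 1 by case: (_ || _).
  by move: lt; rewrite /=; nlia.
have -> : (v == s) = false by apply: contraNF v1; apply: vs1.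
have -> : (v == t) = false by apply: contraNF vl; apply: vtl.
by rewrite /=; move: hS; nlia.
Qed.
End NoWrongEar.

(** * The theorem *)

Lemma spectral_start (R : realType) (k r n : nat) (G : rel 'I_n) :
  2 <= k -> 3 <= r <= 2 * k -> 712 * k <= n -> simple_graph G ->
  (spec_radius R (TK n r) <= spec_radius R G)%R ->
  let a := (n - r + 1)./2 in let b := n - r + 1 - a in
  exists (lam : R) (x : 'I_n -> R),
    [/\ (a%:R * b%:R + b%:R * gain lam (r - 1) <= lam ^+ 2)%R,
        ((a * b)%:R < lam ^+ 2)%R,
        (498 * n%:R <= 1000 * lam)%R & ((n%:R - 2 * k%:R) ^+ 2 <= 4 * lam ^+ 2)%R] /\
    [/\ forall v, (0 <= x v)%R, exists v, (0 < x v)%R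
      & forall v, (lam * x v <= \sum_(u | G v u) x u)%R].
Proof.
move=> k2 r2k nk [symG irrG] spec a b; set m := n - r + 1 in a b *.
have mab : m = a + b by have := odd_double_half m; rewrite /b -/a; nlia.
have ab : a <= b <= a.+1 by have := odd_double_half m; rewrite /b -/a; case: (odd m) => /= h; nlia.
have mE : m + r = n.+1 by rewrite /m; nlia.
have [s0 b0 an bn sn] : [/\ 0 < r - 1, 0 < b, a <= n, b <= n & r - 1 <= n].
  by split; move: mab ab mE; clear -k2 r2k nk; nlia.
have [r1 rn n0] : [/\ 1 < r, r + 2 < n & 0 < n] by split; nlia.
have [lam0 [l0 eql0]] := target_root R s0 b0 an bn sn.
have el0 := TK_eigenvalue r1 rn l0 eql0.
have symTK : symmetric (TK n r).
  by move=> u v; rewrite !(TK_full n0 r1 rn); apply: full_sym.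
have spec0 := le_trans (spec_radius_ge symTK el0) spec.
have lam0pos : (0 < lam0)%R by apply: le_lt_trans l0; apply: ler0n.
have [lam lel el] := spec_radius_attained lam0pos spec0.
have [x [x0 xpos subx]] := eigenvalue_subinvariant symG el.
exists lam, x; split=> //.
have bpos : (0 < b%:R :> R)%R by rewrite ltr0n.
have lampos : (0 < lam)%R := lt_le_trans lam0pos lel.
have sq : (lam0 ^+ 2 <= lam ^+ 2)%R by rewrite lerXn2r // nnegrE ltW.
have g0 : (0 < gain lam0 (r - 1))%R.
  have p1 : (0 < lam0 + 1)%R by rewrite addr_gt0.
  have p2 : (0 < lam0 - (r - 1)%:R)%R by rewrite subr_gt0.
  by apply: divr_gt0; [rewrite ltr0n | apply: mulr_gt0].
have lab : ((a * b)%:R < lam ^+ 2)%R.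
  by rewrite natrM; apply: lt_le_trans sq; rewrite eql0 ltrDl mulr_gt0.
have mm : (m%:R * m%:R <= 4 * (a * b)%:R + 1 :> R)%R.
  have : m * m <= 4 * (a * b) + 1 by move: ab mab; clear; move: m a b => u v z; nia.
  by rewrite -(ler_nat R) (natrD _ (4 * (a * b))) (natrM R m) (natrM R 4).
have mk : (n%:R - 2 * k%:R + 1 <= m%:R :> R)%R.
  have : n + 1 <= m + 2 * k by nlia.
  by rewrite -(ler_nat R) (natrD R n 1) (natrD R m (2 * k)) (natrM R 2); lra.
have kn : (712 * k%:R <= n%:R :> R)%R by rewrite -(natrM R 712) ler_nat.
have k1 : (2 <= k%:R :> R)%R by rewrite (ler_nat R 2).
(* The chain is (n - 2k)^2 <= (m - 1)^2 <= m^2 - 1 <= 4 a b. *)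
have sq4 : ((n%:R - 2 * k%:R) ^+ 2 <= 4 * lam ^+ 2)%R.
  apply: (le_trans (y := (m%:R * m%:R - 1)%R)); last by clear -mm lab; lra.
  apply: (le_trans (y := ((m%:R - 1) ^+ 2)%R)).
    by rewrite lerXn2r ?nnegrE; clear -mk kn k1; lra.
  by clear -mk kn k1; rewrite expr2; nra.
split=> //.
  rewrite -/m; apply: le_trans sq; rewrite eql0 lerD2l ler_pM2l //.
  exact: gain_antitone.
have : (n%:R - 2 * k%:R <= 2 * lam)%R.
  rewrite -ler_sqr ?nnegrE; first by rewrite exprMn; clear -sq4; lra.
    by clear -kn k1; lra.
  by clear -lel lam0pos; lra.
by clear -kn k1; lra.
Qed.

Theorem theorem1p8 (R : realType) (k r n : nat) (G : rel 'I_n) :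
  (2 <= k)%N -> (3 <= r <= 2 * k)%N -> (712 * k <= n)%N ->
  simple_graph G ->
  ~ has_cycle (2 * k + 1) G ->
  (spec_radius R (TK n r) <= spec_radius R G)%R ->
  in_family r G \/ graph_iso G (TK n r).
Proof.
move=> k2 r2k nk simpG noC spec; have [symG irrG] := simpG.
have [lam [x [[lam2 lam_ab lam_lo lam_sq] [x0 xpos subx]]]] := spectral_start k2 r2k nk simpG spec.
have n0 : 0 < n by nlia.
have lampos : (0 < lam)%R.
  have : (0 < n%:R :> R)%R by rewrite ltr0n.
  by clear -lam_lo; lra.
have [H [richH Hbig H40 lam_hi]] := dense_core simpG noC k2 nk lampos lam_sq x0 xpos subx.
have nwe := no_wrong_ear k2 r2k nk symG irrG noC richH Hbig H40 lam_lo lam_hi lam_ab x0 xpos subx.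
have [B [c [SB nB eB]]] := ear_closure symG nwe.
have HB d : H d \subset B.
  by apply: fintype.subset_trans SB; apply/fintype.subsetP => v /(H_core symG k2 noC richH)[].
have [b0 b0H] : exists b0, b0 \in H false.
  by apply/card_gt0P; have := H40 false; nlia.
(* The edge from [b0] to [b1] lies in [B], so its ends show that both values of the colouring [c]
   occur there. *)
have [b1 [b1H b01 _]] : exists u, [/\ u \in H true, G b0 u & u \notin [::]].
  by apply: pick_nbr (richH _ _ b0H) _; nlia.
have b0B := fintype.subsetP (HB false) _ b0H.
have b1B := fintype.subsetP (HB true) _ b1H.
have [att [attB attid attG attb]] := attachment symG b0B eB.
have neqG u v : G u v -> u != v by move=> uv; apply: contraTneq uv => ->; rewrite irrG.
have colB u v : u \in B -> v \in B -> G u v -> c u != c v.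
  move=> uB vB uv; have := nB u [::] v.
  rewrite /wrong_ear /ear uB vB /= uv inE neqG //= eqbF_neg negbK.
  by case: (c u) (c v) => [] [].
have Gfull u v : G u v -> full B c att u v.
  move=> uv; rewrite /full (neqG u v uv) andbT.
  case: (boolP (u \in B)) => uB; case: (boolP (v \in B)) => vB /=.
  - by rewrite colB.
  - by rewrite attid // (attb u v) ?eqxx.
  - by rewrite (attid v vB) (attb v u) ?eqxx // symG.
  - by rewrite (attG u v).
have color d : exists2 v, v \in B & c v = d.
  have := colB _ _ b0B b1B b01; case: (eqVneq (c b0) d) => [<- _|n0d n01].
    by exists b0.
  by exists b1 => //; move: n0d n01; case: (c b0) (c b1) d => [] [] [].
have smallW : 20 * #|~: B| <= n.
  apply: leq_trans Hbig; rewrite leq_mul2l /=; apply: subset_leq_card.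
  by rewrite setCS subUset !HB.
have cardT : #|'I_n| = n by apply: card_ord.
have [small|[eqG cW [v vB [pv cv]]]] := pendant_dichotomy cardT attB attid color symG Gfull
  x0 xpos subx k2 r2k nk smallW lam_lo lam2.
  by left; apply: pendant_family simpG Gfull attB attid b0B small.
right; have [r1 rn] : 1 < r /\ r + 2 < n by split; nlia.
exact: (@pendant_iso_TK n r n0 r1 rn G B c att v eqG attid vB cW pv cv).
Qed.
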